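(* Let $K|\mathbb{Q}_p$ be a field complete for a valuation $v$ with values in $\mathbb{R}$, $v(p)=1$. If $H_1$ and $H_2$ are two isogenous $p$-divisible groups over $\mathcal{O}_K$, then $$\mathrm{HN}(H_1)=\mathrm{HN}(H_2),$$ where $\mathrm{HN}$ denotes the renormalized Harder–Narasimhan polygon.
   Context: For a finite flat commutative group scheme $G$ of $p$-power order over $\mathcal{O}_K$: $\deg G=\sum_i v(a_i)$ if $\omega_G\simeq\bigoplus_i\mathcal{O}_K/(a_i)$, $\mathrm{ht}\,G=\log_p|G|$, and $\mathrm{HN}(G):[0,\mathrm{ht}\,G]\to[0,\deg G]$ is the upper concave envelope of the points $(\mathrm{ht}\,G',\deg G')$ where $G'$ runs over the finite flat closed subgroup schemes of $G$. For a $p$-divisible group $H$ over $\mathcal{O}_K$, the renormalized polygon is the concave function $\mathrm{HN}(H):[0,\mathrm{ht}\,H]\to[0,\dim H]$, $\mathrm{HN}(H)(x)=\lim_{n\to+\infty}\frac1n\mathrm{HN}(H[p^n])(nx)$ (the limit exists, is uniform in $x$, and equals the infimum over $n\geq 1$). *)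

(* Defs.v *)
From HB Require Import structures.
From mathcomp Require Import all_boot all_order all_algebra.
From mathcomp Require Import all_classical all_reals all_analysis.
From mathcomp Require mpoly.
Import (canonicals) mpoly.

Set Implicit Arguments.
Unset Strict Implicit.
Unset Printing Implicit Defensive.

Import Order.TTheory GRing.Theory Num.Theory.
Import numFieldNormedType.Exports.
Local Open Scope classical_set_scope.
Local Open Scope ring_scope.

Record valuation (K : fieldType) (R : realType) := Valuation {
  vfun :> K -> \bar R;
  vfun_neqNy : forall x, vfun x <> -oo%E;
  vfun_eqy : forall x, vfun x = +oo%E <-> x = 0;
  vfunM : forall x y, vfun (x * y) = (vfun x + vfun y)%E;
  vfunD : forall x y, (Order.min (vfun x) (vfun y) <= vfun (x + y)%R)%E }.

Section ValuationRing.
Variables (K : fieldType) (R : realType) (v : valuation K R).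

(* A field complete for a valuation with v p = 1, p prime, has characteristic 0,
   v is the p-adic valuation on its rational numbers, and the closure of these
   is Q_p; so such a field is automatically an extension of Q_p. *)
Definition complete_for : Prop :=
  forall u : nat -> K,
    (forall M : R, exists N, forall m n, (N <= m)%N -> (N <= n)%N ->
       (M%:E <= v (u m - u n)%R)%E) ->
    exists l : K, forall M : R, exists N, forall n, (N <= n)%N ->
       (M%:E <= v (u n - l)%R)%E.

Definition val_integral : {pred K} := fun x => (0 <= v x)%E.

Lemma vfun1 : v 1 = 0%E.
Proof.
have := vfunM v 1 1; rewrite mulr1.
case E : (v 1) => [r||].
- by rewrite -EFinD => -[] /eqP; rewrite eq_sym -subr_eq0 addrK => /eqP ->.
- by move/(vfun_eqy v 1) : E => /eqP; rewrite oner_eq0.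
- by move/vfun_neqNy : E.
Qed.

Lemma vfunN1 : v (-1) = 0%E.
Proof.
have := vfunM v (-1) (-1); rewrite mulrNN mulr1 vfun1.
case E : (v (-1)) => [r||] //.
rewrite -EFinD => -[] /eqP.
by rewrite -mulr2n eq_sym mulrn_eq0 /= => /eqP ->.
Qed.

Lemma val_integral_subring : subring_closed val_integral.
Proof.
split; rewrite /val_integral.
- by rewrite unfold_in vfun1.
- move=> x y; rewrite !unfold_in => x0 y0.
  apply: le_trans (vfunD v x (- y)).
  by rewrite le_min x0 -mulN1r vfunM vfunN1 add0e.
- by move=> x y; rewrite !unfold_in => x0 y0; rewrite vfunM adde_ge0.
Qed.

HB.instance Definition _ :=
  GRing.isSubringClosed.Build K val_integral val_integral_subring.

Record val_ring := ValRing { val_ring_val : K; _ : val_ring_val \in val_integral }.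

HB.instance Definition _ := [isSub for val_ring_val].
HB.instance Definition _ := [Choice of val_ring by <:].
HB.instance Definition _ := [SubChoice_isSubComNzRing of val_ring by <:].

End ValuationRing.

Definition lrcomp (S : comNzRingType) (A B C : comAlgType S)
    (h : {lrmorphism B -> C}) (x : {lrmorphism A -> B}) : {lrmorphism A -> C} :=
  h \o x.

(* An affine commutative group scheme Spec A over S is given by A together with
   a group law on its functor of points B |-> Hom(A, B), natural in the
   S-algebra B. A comAlgType is nonzero; the zero algebra carries no
   information, since every affine scheme has exactly one point over it. *)
Record gscheme (S : comNzRingType) := GScheme {
  gs_alg :> comAlgType S;
  gs_zero : forall B : comAlgType S, {lrmorphism gs_alg -> B};
  gs_opp : forall B : comAlgType S,
    {lrmorphism gs_alg -> B} -> {lrmorphism gs_alg -> B};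
  gs_add : forall B : comAlgType S,
    {lrmorphism gs_alg -> B} -> {lrmorphism gs_alg -> B} ->
    {lrmorphism gs_alg -> B};
  gs_addA : forall B, associative (@gs_add B);
  gs_addC : forall B, commutative (@gs_add B);
  gs_add0 : forall B, left_id (gs_zero B) (@gs_add B);
  gs_addN : forall B, left_inverse (gs_zero B) (@gs_opp B) (@gs_add B);
  gs_add_nat : forall (B C : comAlgType S) (h : {lrmorphism B -> C}) x y,
    lrcomp h (gs_add x y) = gs_add (lrcomp h x) (lrcomp h y) }.

Section GroupSchemes.
Variable S : comNzRingType.
Implicit Types (G : gscheme S) (A B C : comAlgType S).

Definition point G B := {lrmorphism G -> B}.

Definition pzero G B : point G B := gs_zero G B.

Definition pmuln G B (n : nat) (x : point G B) : point G B :=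
  iter n (gs_add x) (pzero G B).

Record ghom G1 G2 := GHom {
  gh_alg :> {lrmorphism G2 -> G1};
  gh_add : forall B (x y : point G1 B),
    lrcomp (gs_add x y) gh_alg =
    gs_add (lrcomp x gh_alg) (lrcomp y gh_alg) }.

Definition happ G1 G2 (f : ghom G1 G2) B (x : point G1 B) : point G2 B :=
  lrcomp x (gh_alg f).

Definition free_of_rank (M : lmodType S) (n : nat) : Prop :=
  exists b : 'I_n -> M,
    bijective (fun c : {ffun 'I_n -> S} => \sum_i c i *: b i).

(* Over a local base such as a valuation ring, a module that is finite and flat
   is free. *)
Definition finite_flat G : Prop := exists n, free_of_rank G n.

Definition order G : nat := xget 0%N [set n | free_of_rank G n].

Definition closed_immersion G1 G2 (f : ghom G1 G2) : Prop :=
  forall a : G1, exists b : G2, gh_alg f b = a.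

Definition aug_ideal G : set G := [set a | pzero G (S^o : comAlgType S) a = 0].

Definition aug_ideal_sq G : set G := [set x |
  exists (m : nat) (y z : 'I_m -> G),
    (forall j, aug_ideal (y j) /\ aug_ideal (z j)) /\
    x = \sum_j y j * z j].

(* omega_G = I / I^2, I the augmentation ideal; the w_i are representatives of
   the images in I / I^2 of the standard generators of the direct sum of the
   S / (a_i). *)
Definition omega_iso G (r : nat) (a : 'I_r -> S) : Prop :=
  exists w : 'I_r -> G,
    [/\ forall i, aug_ideal (w i),
        forall x, aug_ideal x ->
          exists c : 'I_r -> S, aug_ideal_sq (x - \sum_i c i *: w i) &
        forall c : 'I_r -> S,
          aug_ideal_sq (\sum_i c i *: w i) <->
          forall i, exists b, c i = a i * b].

End GroupSchemes.

Section Fppf.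
Variable S : comNzRingType.
Variables (B C : comAlgType S) (h : {lrmorphism B -> C}).

(* Equational form of flatness: every linear relation in C with coefficients in
   B is a C-linear combination of relations in B. *)
Definition flat_map : Prop :=
  forall (k : nat) (b : 'I_k -> B) (c : 'I_k -> C),
    \sum_i h (b i) * c i = 0 ->
    exists (m : nat) (a : 'I_k -> 'I_m -> B) (d : 'I_m -> C),
      (forall i, c i = \sum_j h (a i j) * d j) /\
      (forall j, \sum_i b i * a i j = 0).

(* With flatness: no proper ideal of B generates the unit ideal of C. *)
Definition faithful_map : Prop :=
  forall (k : nat) (b : 'I_k -> B),
    (exists c : 'I_k -> C, \sum_i h (b i) * c i = 1) ->
    exists c : 'I_k -> B, \sum_i b i * c i = 1.

Definition finitely_presented_map : Prop :=
  exists (k : nat) (u : 'I_k -> C),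
    (forall c, exists P : mpoly.mpoly k B, mpoly.mmap h u P = c) /\
    exists (l : nat) (F : 'I_l -> mpoly.mpoly k B),
      forall P : mpoly.mpoly k B,
        mpoly.mmap h u P = 0 <->
        exists Q : 'I_l -> mpoly.mpoly k B, P = \sum_j Q j * F j.

Definition fppf_map : Prop :=
  [/\ flat_map, faithful_map & finitely_presented_map].

End Fppf.

(* pd_lev n is the p^n-torsion subgroup; pd_exact says that pd_incl n identifies
   it with the kernel of p^n on pd_lev n.+1. *)
Record pdiv_group (S : comNzRingType) (p : nat) := PDivGroup {
  pd_ht : nat;
  pd_lev :> nat -> gscheme S;
  pd_rank : forall n, free_of_rank (pd_lev n) (p ^ (n * pd_ht));
  pd_incl : forall n, ghom (pd_lev n) (pd_lev n.+1);
  pd_incl_inj : forall n B, injective (@happ S _ _ (pd_incl n) B);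
  pd_exact : forall n B (x : point (pd_lev n.+1) B),
    pmuln (p ^ n) x = pzero _ B <->
    exists y : point (pd_lev n) B, happ (pd_incl n) y = x }.

Section PDivisible.
Variables (S : comNzRingType) (p : nat).
Implicit Types (H : pdiv_group S p) (B C : comAlgType S).

Record pd_hom H1 H2 := PDHom {
  ph_lev :> forall n, ghom (H1 n) (H2 n);
  ph_incl : forall n B (x : point (H1 n) B),
    happ (ph_lev n.+1) (happ (pd_incl H1 n) x) =
    happ (pd_incl H2 n) (happ (ph_lev n) x) }.

Fixpoint pd_trans H (k n : nat) B (x : point (H n) B) : point (H (k + n)%N) B :=
  if k is k'.+1 then happ (pd_incl H (k' + n)) (pd_trans k' x) else x.

(* The kernel of f, as a sheaf on affine schemes, is the union of the kernels of
   the f_n. A finite E representing it is quasi-compact, so it lands in some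
   H1[p^N], and then all of the kernel lies in H1[p^N]. *)
Definition finite_flat_kernel H1 H2 (f : pd_hom H1 H2) : Prop :=
  exists (N : nat) (E : gscheme S) (iota : ghom E (H1 N)),
    [/\ finite_flat E,
        forall B, injective (@happ S _ _ iota B),
        forall B (x : point (H1 N) B),
          happ (f N) x = pzero _ B <-> exists y, happ iota y = x &
        forall n B (x : point (H1 n) B),
          happ (f n) x = pzero _ B -> pmuln (p ^ N) x = pzero _ B].

Definition fppf_epi H1 H2 (f : pd_hom H1 H2) : Prop :=
  forall n B (y : point (H2 n) B),
    exists (C : comAlgType S) (h : {lrmorphism B -> C}), fppf_map h /\
    exists (k : nat) (x : point (H1 (k + n)%N) C),
      happ (f (k + n)%N) x = lrcomp h (pd_trans k y).

Definition isogeny H1 H2 (f : pd_hom H1 H2) : Prop :=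
  fppf_epi f /\ finite_flat_kernel f.

Definition isogenous H1 H2 : Prop := exists f : pd_hom H1 H2, isogeny f.

End PDivisible.

(* The least concave function on [0, b] lying above the points of P. *)
Definition upper_concave_envelope (R : realType) (b : R) (P : set (R * R))
    (x : R) : R :=
  inf [set f x | f in [set f : R -> R |
    @convex_function R R^o `[0, b] (fun t => - f t) /\
    forall t, P t -> t.2 <= f t.1]].

Section HarderNarasimhan.
Variables (R : realType) (p : nat) (K : fieldType) (v : valuation K R).
Local Notation OK := (val_ring v).

Definition ht (G : gscheme OK) : R := ln (order G)%:R / ln p%:R.

Definition deg (G : gscheme OK) : R := xget 0 [set d : R |
  exists (r : nat) (a : 'I_r -> OK),
    omega_iso G a /\ d%:E = (\sum_i v (val (a i)))%E].

Definition HN_points (G : gscheme OK) : set (R * R) := [set t |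
  exists (G' : gscheme OK) (iota : ghom G' G),
    [/\ finite_flat G', closed_immersion iota & t = (ht G', deg G')]].

Definition HN (G : gscheme OK) : R -> R :=
  upper_concave_envelope (ht G) (HN_points G).

Definition HN_pdiv (H : pdiv_group OK p) (x : R) : R :=
  lim ((fun n : nat => n%:R^-1 * HN (H n) (n%:R * x)) @ \oo).

End HarderNarasimhan.

(* Main.v *)
(* Let f : H1 -> H2 be an isogeny whose kernel is killed by p^N. Since p^N x only
   depends on f x, fppf descent gives homomorphisms g_n : H2[p^n] -> H1[p^n] with
   f g_n = p^N; so f and g_n both have kernels killed by p^N at every level n.
   Counting points in a domain then shows that H1 and H2 have the same height.
   Let phi be f_n or g_n, G' a closed subgroup of its source and G'' the schematic
   image of G' under phi. Then ht G'' <= ht G', and the cokernel of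
   omega_G'' -> omega_G' is killed by p^N and generated by d elements, where d
   bounds the number of generators of omega_H[p^n] and is independent of n because
   omega_H[p^(n+1)] / p^n = omega_H[p^n]. Fitting ideals give
   deg G' <= deg G'' + N d. Hence the polygons of H1[p^n] and H2[p^n] differ by a
   bounded amount, which disappears in the renormalized limit. *)
From HB Require Import structures.
Require Import Defs.
From mathcomp Require Import all_boot all_order all_fingroup all_algebra.
From mathcomp Require Import all_classical all_reals all_analysis.
From mathcomp Require Import ring zify.
From mathcomp Require mpoly.
Import (canonicals, coercions) mpoly.
Import Order.TTheory GRing.Theory Num.Theory.
Import numFieldNormedType.Exports.
Set Implicit Arguments.
Unset Strict Implicit.
Unset Printing Implicit Defensive.
Local Open Scope ring_scope.

(** * Quotient algebras *)

(** Group laws are given on points only, so Hopf-algebraic facts come from evaluating at universal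
    points: the coproduct from the two tautological points over G ⊗ G, the equations of a kernel
    from the tautological point of a quotient algebra. The map [n] has differential n on the
    cotangent space; as [p^N] is trivial on the kernel of phi, p^N kills the cokernel of the
    pullback on omega. The constant d is the rank of the algebra of H[p]. The valuation need not be
    discrete, so the base may fail to be Noetherian. What replaces this is total divisibility: it
    gives a Smith form for every matrix, hence freeness of schematic images and diagonal
    presentations of omega. Points are counted in a domain built for the purpose, one point being
    adjoined at a time. At level n the count compares n ht H1 with n ht H2 up to N ht H1, an error
    independent of n, so a large level decides between the heights. *)

Section AlgebraMorphisms.
Variable S : comNzRingType.
Implicit Types A B C : comAlgType S.

Lemma lrmorphism_ext A B (f g : {lrmorphism A -> B}) : f =1 g -> f = g.
Proof.
case: f => f [[fD] [fM] [fZ]]; case: g => g [[gD] [gM] [gZ]] /= fg.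
have {}fg : f = g by apply: funext.
subst g.
rewrite (Prop_irrelevance fD gD) (Prop_irrelevance fM gM).
by rewrite (Prop_irrelevance fZ gZ).
Qed.

Section Laws.
Context A B (f : {lrmorphism A -> B}).
Lemma lrmD x y : f (x + y) = f x + f y. Proof. exact: rmorphD. Qed.
Lemma lrmB x y : f (x - y) = f x - f y. Proof. exact: rmorphB. Qed.
Lemma lrmM x y : f (x * y) = f x * f y. Proof. exact: rmorphM. Qed.
Lemma lrmZ s x : f (s *: x) = s *: f x. Proof. exact: linearZ. Qed.
Lemma lrm0 : f 0 = 0. Proof. exact: rmorph0. Qed.
Lemma lrm1 : f 1 = 1. Proof. exact: rmorph1. Qed.
Lemma lrmMn x n : f (x *+ n) = f x *+ n. Proof. exact: rmorphMn. Qed.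
Lemma lrm_sum I (r : seq I) (P : pred I) E :
  f (\sum_(i <- r | P i) E i) = \sum_(i <- r | P i) f (E i).
Proof. exact: rmorph_sum. Qed.
End Laws.

Lemma rmorphism_of (R1 R2 : comNzRingType) (f : R1 -> R2) :
    {morph f : x y / x + y} -> f 1 = 1 -> {morph f : x y / x * y} ->
  exists g : {rmorphism R1 -> R2}, g =1 f.
Proof.
move=> fD f1 fM.
have fB : zmod_morphism f.
  move=> x y; rewrite fD; congr (_ + _); apply: (addrI (f y)).
  by rewrite -fD !subrr; apply: (addrI (f 0)); rewrite -fD !addr0.
pose m1 := GRing.isZmodMorphism.Build R1 R2 f fB.
pose m2 := GRing.isMonoidMorphism.Build R1 R2 f (conj f1 fM).
pose g : {rmorphism R1 -> R2} := HB.pack f m1 m2.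
by exists g.
Qed.

Lemma lrmorphism_of A B (f : A -> B) :
    {morph f : x y / x + y} -> (forall s, {morph f : x / s *: x}) ->
    f 1 = 1 -> {morph f : x y / x * y} ->
  exists g : {lrmorphism A -> B}, g =1 f.
Proof.
move=> fD fZ f1 fM.
have flin : linear f by move=> s x y; rewrite fD fZ.
pose m1 := GRing.isLinear.Build S A B *:%R f flin.
pose m2 := GRing.isMonoidMorphism.Build A B f (conj f1 fM).
pose g : {lrmorphism A -> B} := HB.pack f m1 m2.
by exists g.
Qed.

Lemma in_alg_lrmorphism B :
  exists g : {lrmorphism (S^o : comAlgType S) -> B}, g =1 in_alg B.
Proof.
apply: lrmorphism_of; first exact: rmorphD.
- by move=> s x /=; rewrite scalerA.
- by rewrite rmorph1.
- exact: rmorphM.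
Qed.

End AlgebraMorphisms.

(** A copy of [R'] with [eta] in its type, so that inference finds the [S]-module structure through
    [eta]. *)
Definition alg_of (S R' : comNzRingType) (eta : {rmorphism S -> R'}) : Type := R'.

Section AlgOf.
Variables (S R' : comNzRingType) (eta : {rmorphism S -> R'}).
Local Notation Q := (alg_of eta).

HB.instance Definition _ := GRing.ComNzRing.on Q.

Definition alg_of_scale (s : S) (x : Q) : Q := eta s * (x : R').

Fact alg_of_scaleA s t x :
  alg_of_scale s (alg_of_scale t x) = alg_of_scale (s * t) x.
Proof. by rewrite /alg_of_scale rmorphM mulrA. Qed.
Fact alg_of_scale1 : left_id 1 alg_of_scale.
Proof. by move=> x; rewrite /alg_of_scale rmorph1 mul1r. Qed.
Fact alg_of_scaleDr : right_distributive alg_of_scale +%R.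
Proof. by move=> s x y; rewrite /alg_of_scale mulrDr. Qed.
Fact alg_of_scaleDl x : {morph (alg_of_scale^~ x) : s t / s + t}.
Proof. by move=> s t; rewrite /alg_of_scale rmorphD mulrDl. Qed.

HB.instance Definition _ := GRing.Zmodule_isLmodule.Build S Q
  alg_of_scaleA alg_of_scale1 alg_of_scaleDr alg_of_scaleDl.

Fact alg_of_scaleAl s (x y : Q) : s *: (x * y) = s *: x * y.
Proof. exact: mulrA. Qed.
HB.instance Definition _ := GRing.Lmodule_isLalgebra.Build S Q alg_of_scaleAl.
HB.instance Definition _ := GRing.Lalgebra_isComAlgebra.Build S Q.

Lemma alg_ofZ s (x : Q) : s *: x = eta s * (x : R').
Proof. by []. Qed.
End AlgOf.

Definition ideal (R' : comNzRingType) (J : set R') :=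
  [/\ J 0, forall x y, J x -> J y -> J (x + y) & forall r x, J x -> J (r * x)].

Section QuotientAlgebra.
Local Open Scope quotient_scope.

Lemma quotient_ring (R' : comNzRingType) (J : set R') : ideal J -> ~ J 1 ->
  exists (Q : comNzRingType) (pi : {rmorphism R' -> Q}),
    (forall q, exists x, pi x = q) /\ forall x, pi x = 0 <-> J x.
Proof.
move=> [J0 JD JM] J1.
pose Jp : {pred R'} := fun x => `[< J x >].
have Jid : idealr_closed Jp.
  split; first exact/asboolP.
    by apply/negP => /asboolP.
  move=> a x y /asboolP Jx /asboolP Jy; apply/asboolP.
  by apply: JD => //; apply: JM.
pose mI := isIdealr.Build R' Jp Jid.
pose I : idealr R' := HB.pack Jp mI.
exists {ideal_quot I}, (\pi_{ideal_quot I} : {rmorphism R' -> {ideal_quot I}}).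
split=> [q|x]; first by exists (generic_quotient.repr q); apply: reprK.
have xE : (\pi_{ideal_quot I} x == \pi_{ideal_quot I} 0) = `[< J x >].
  by rewrite -Quotient.idealrBE subr0.
have pi0 : \pi_{ideal_quot I} 0 = 0.
  exact: (rmorph0 (\pi_{ideal_quot I} : {rmorphism R' -> {ideal_quot I}})).
split=> [x0|Jx].
  by apply/asboolP; rewrite -xE; apply/eqP; rewrite pi0.
by apply: etrans pi0; apply/eqP; rewrite xE; apply/asboolP.
Qed.

End QuotientAlgebra.

Lemma quotient_alg (S R' : comNzRingType) (eta : {rmorphism S -> R'}) (J : set R') :
    ideal J -> ~ J 1 ->
  exists (Q : comAlgType S) (pi : {rmorphism R' -> Q}),
    [/\ forall q, exists x, pi x = q, forall x, pi x = 0 <-> J x &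
        forall s, pi (eta s) = s%:A].
Proof.
move=> Jid J1; have [Q [pi [pi_surj pi0]]] := quotient_ring Jid J1.
pose c : {rmorphism S -> Q} := pi \o eta.
exists (alg_of c), (pi : {rmorphism R' -> alg_of c}); split=> // s.
by rewrite alg_ofZ mulr1.
Qed.

Section Factor.
Variable S : comNzRingType.
Implicit Types A B C : comAlgType S.

Lemma quotient_lalg A (J : set A) : ideal J -> ~ J 1 ->
  exists (Q : comAlgType S) (pi : {lrmorphism A -> Q}),
    (forall q, exists x, pi x = q) /\ forall x, pi x = 0 <-> J x.
Proof.
move=> Jid J1.
have [Q [pi [pi_surj pi0 piZ]]] := quotient_alg (in_alg A) Jid J1.
have [] := @lrmorphism_of S A Q pi; rewrite ?rmorph1 //.
- exact: rmorphD.
- by move=> s x; rewrite -[s *: x]mulr_algl rmorphM piZ mulr_algl.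
- exact: rmorphM.
by move=> g gE; exists Q, g; split=> [q|x]; [have [x <-] := pi_surj q; exists x|];
  rewrite gE.
Qed.

Lemma factor_lrmorphism A B C (pi : {lrmorphism A -> B}) (x : {lrmorphism A -> C}) :
    (forall b, exists a, pi a = b) -> (forall a, pi a = 0 -> x a = 0) ->
  exists y : {lrmorphism B -> C}, lrcomp y pi = x.
Proof.
move=> /choice[r rK] kx.
have xE a a' : pi a = pi a' -> x a = x a'.
  by move=> e; apply/eqP; rewrite -subr_eq0 -lrmB; apply/eqP/kx;
     rewrite lrmB e subrr.
have [] := @lrmorphism_of S B C (x \o r).
- by move=> b b' /=; rewrite -lrmD; apply: xE; rewrite lrmD /= !rK.
- by move=> s b /=; rewrite -lrmZ; apply: xE; rewrite lrmZ /= !rK.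
- by rewrite /= -(lrm1 x); apply: xE; rewrite rK [RHS]lrm1.
- by move=> b b' /=; rewrite -lrmM; apply: xE; rewrite lrmM /= !rK.
move=> y yE; exists y; apply: lrmorphism_ext => a /=.
by rewrite yE /=; apply: xE; rewrite rK.
Qed.

Lemma lrcomp_surj_inj A B C (pi : {lrmorphism A -> B}) (x y : {lrmorphism B -> C}) :
  (forall b, exists a, pi a = b) -> lrcomp x pi = lrcomp y pi -> x = y.
Proof.
move=> sur e; apply: lrmorphism_ext => b; have [a <-] := sur b.
by have := congr1 (fun f : {lrmorphism A -> C} => f a) e.
Qed.

Lemma ker_ideal A B (f : {lrmorphism A -> B}) : ideal [set a | f a = 0].
Proof.
split=> /=; first exact: lrm0.
- by move=> x y fx fy; rewrite lrmD fx fy addr0.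
- by move=> r x fx; rewrite lrmM fx mulr0.
Qed.

End Factor.

(** * The group of points *)

Section PointGroup.
Variable S : comNzRingType.
Implicit Types (G : gscheme S) (A B C D : comAlgType S).

Lemma lrcompA A B C D (h : {lrmorphism C -> D}) (g : {lrmorphism B -> C})
  (f : {lrmorphism A -> B}) : lrcomp h (lrcomp g f) = lrcomp (lrcomp h g) f.
Proof. exact: lrmorphism_ext. Qed.

Lemma lrcompE A B C (h : {lrmorphism B -> C}) (f : {lrmorphism A -> B}) a :
  lrcomp h f a = h (f a).
Proof. by []. Qed.

(** A copy of [point] that carries the group law as a [zmodType], so that sums and multiples of
    points use the additive notation and its lemmas. *)
Definition gpoint G B := {lrmorphism G -> B}.
HB.instance Definition _ G B := gen_eqMixin (gpoint G B).
HB.instance Definition _ G B := gen_choiceMixin (gpoint G B).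
HB.instance Definition _ G B := GRing.isZmodule.Build (gpoint G B)
  (@gs_addA S G B) (@gs_addC S G B) (@gs_add0 S G B) (@gs_addN S G B).

Lemma pmulnE G B n (x : gpoint G B) : pmuln n x = x *+ n.
Proof.
elim: n => [|n IH]; first by rewrite mulr0n.
by rewrite mulrS -IH.
Qed.

Definition pmap G B C (h : {lrmorphism B -> C}) (x : gpoint G B) : gpoint G C :=
  lrcomp h x.

Fact pmap_additive G B C (h : {lrmorphism B -> C}) : nmod_morphism (@pmap G B C h).
Proof.
have hD : {morph @pmap G B C h : x y / x + y} by move=> x y; apply: gs_add_nat.
by split=> //; apply: (addrI (pmap h 0)); rewrite -hD !addr0.
Qed.
HB.instance Definition _ G B C h :=
  GRing.isNmodMorphism.Build _ _ (@pmap G B C h) (@pmap_additive G B C h).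

Definition hmap G1 G2 (f : ghom G1 G2) B (x : gpoint G1 B) : gpoint G2 B := happ f x.

Fact hmap_additive G1 G2 (f : ghom G1 G2) B : nmod_morphism (@hmap _ _ f B).
Proof.
have hD : {morph @hmap _ _ f B : x y / x + y} by move=> x y; apply: gh_add.
by split=> //; apply: (addrI (hmap f 0)); rewrite -hD !addr0.
Qed.
HB.instance Definition _ G1 G2 f B :=
  GRing.isNmodMorphism.Build _ _ (@hmap G1 G2 f B) (@hmap_additive G1 G2 f B).

Lemma pmap_hmap G1 G2 (f : ghom G1 G2) B C (h : {lrmorphism B -> C}) x :
  pmap h (hmap f x) = hmap f (pmap h x).
Proof. exact: lrcompA. Qed.

Lemma pmapE G B C (h : {lrmorphism B -> C}) (x : gpoint G B) a : pmap h x a = h (x a).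
Proof. by []. Qed.

Lemma pmap_comp G B C D (h : {lrmorphism B -> C}) (g : {lrmorphism C -> D})
  (x : gpoint G B) : pmap g (pmap h x) = pmap (lrcomp g h) x.
Proof. exact: lrcompA. Qed.

Lemma hmapE G1 G2 (f : ghom G1 G2) B (x : gpoint G1 B) a : hmap f x a = x (gh_alg f a).
Proof. by []. Qed.

Lemma pmap_inj G B C (h : {lrmorphism B -> C}) :
  injective h -> injective (@pmap G B C h).
Proof.
move=> hI x y e; apply: lrmorphism_ext => a; apply: hI.
by have := congr1 (fun z : gpoint G C => z a) e.
Qed.

Lemma point_ext G B (x y : gpoint G B) : x =1 y -> x = y.
Proof. exact: lrmorphism_ext. Qed.

(** The universal point: by [pmap_idp] every point is an image of it, so a natural identity between
    points can be checked here. *)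
Definition idp G : gpoint G G := (idfun : {lrmorphism G -> G}).

Lemma pmap_idp G B (x : gpoint G B) : pmap x (idp G) = x.
Proof. exact: lrmorphism_ext. Qed.

Definition eps G : {lrmorphism G -> (S^o : comAlgType S)} := pzero G S^o.

Lemma aug_idealE G a : aug_ideal a <-> eps G a = 0.
Proof. by []. Qed.

Lemma zero_pointE G B a : (0 : gpoint G B) a = (eps G a)%:A.
Proof.
have [g gE] := in_alg_lrmorphism B.
by have <- : pmap g (0 : gpoint G S^o) = 0 := raddf0 _; rewrite pmapE gE.
Qed.

Lemma eps_hom G1 G2 (f : ghom G1 G2) a : eps G1 (gh_alg f a) = eps G2 a.
Proof.
have := congr1 (fun z : gpoint G2 (S^o : comAlgType S) => z a) (raddf0 (@hmap _ _ f S^o)).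
by rewrite hmapE.
Qed.

Fact comp_hom_add (G1 G2 G3 : gscheme S) (f : ghom G1 G2) (g : ghom G2 G3) B
    (x y : Defs.point G1 B) :
  lrcomp (gs_add x y) (lrcomp (gh_alg f) (gh_alg g)) =
  gs_add (lrcomp x (lrcomp (gh_alg f) (gh_alg g)))
         (lrcomp y (lrcomp (gh_alg f) (gh_alg g))).
Proof. by rewrite !lrcompA gh_add gh_add. Qed.

Definition comp_hom (G1 G2 G3 : gscheme S) (f : ghom G1 G2) (g : ghom G2 G3) :
  ghom G1 G3 := GHom (@comp_hom_add G1 G2 G3 f g).

Lemma hmap_comp (G1 G2 G3 : gscheme S) (f : ghom G1 G2) (g : ghom G2 G3) B
  (x : gpoint G1 B) : hmap (comp_hom f g) x = hmap g (hmap f x).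
Proof. exact: lrcompA. Qed.

Definition id_hom (G : gscheme S) : ghom G G.
Proof.
exists (idfun : {lrmorphism G -> G}) => B x y.
have e z : lrcomp z (idfun : {lrmorphism G -> G}) = z by apply: lrmorphism_ext.
by rewrite !e.
Defined.

Lemma hmap_id (G : gscheme S) B (x : gpoint G B) : hmap (id_hom G) x = x.
Proof. exact: lrmorphism_ext. Qed.

Lemma eps_sub G a : eps G (a - (eps G a)%:A) = 0.
Proof. by rewrite lrmB lrmZ lrm1 /GRing.scale /= mulr1 subrr. Qed.

End PointGroup.

(** * Tensor products *)

Section Bases.
Variable S : comNzRingType.

Definition is_basis (M : lmodType S) n (b : 'I_n -> M) (co : M -> 'I_n -> S) :=
  (forall x, x = \sum_i co x i *: b i) /\
  (forall c i, co (\sum_i c i *: b i) i = c i).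

Lemma free_of_rankP (M : lmodType S) n :
  free_of_rank M n <-> exists (b : 'I_n -> M) co, is_basis b co.
Proof.
split=> -[b].
  case=> g gK Kg; exists b, (fun x i => g x i); split=> [x|c i].
    by rewrite [LHS](_ : x = \sum_i g x i *: b i) // [RHS]Kg.
  have := gK [ffun i => c i]; rewrite (eq_bigr (fun i => c i *: b i)) => [->|j _].
    by rewrite ffunE.
  by rewrite ffunE.
case=> co [bP coP]; exists b, (fun x => [ffun i => co x i]) => [c|x].
  by apply/ffunP => i; rewrite ffunE coP.
by rewrite [RHS]bP; apply: eq_bigr => i _; rewrite ffunE.
Qed.

Section Coordinates.
Context (M : lmodType S) n (b : 'I_n -> M) co (bco : is_basis b co).

Lemma basisE x : x = \sum_i co x i *: b i. Proof. exact: bco.1. Qed.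
Lemma coordE c i : co (\sum_i c i *: b i) i = c i. Proof. exact: bco.2. Qed.
Lemma coordD x y i : co (x + y) i = co x i + co y i.
Proof.
rewrite {1}(basisE x) {1}(basisE y) -big_split /=.
by under eq_bigr do rewrite -scalerDl; rewrite coordE.
Qed.
Lemma coordZ s x i : co (s *: x) i = s * co x i.
Proof.
rewrite {1}(basisE x) scaler_sumr.
by under eq_bigr do rewrite scalerA; rewrite coordE.
Qed.
Lemma coord0 i : co 0 i = 0.
Proof. by rewrite -(scale0r 0) coordZ mul0r. Qed.
Lemma coord_sum I (r : seq I) (P : pred I) F i :
  co (\sum_(j <- r | P j) F j) i = \sum_(j <- r | P j) co (F j) i.
Proof.
elim/big_rec2 : _ => [|j y z _ <-]; first exact: coord0.
by rewrite coordD.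
Qed.
Lemma coord_basis j i : co (b j) i = (i == j)%:R.
Proof.
rewrite -[b j](_ : \sum_i (i == j)%:R *: b i = _) ?coordE //.
rewrite (bigD1 j) //= eqxx scale1r big1 ?addr0 // => k /negbTE ->.
by rewrite scale0r.
Qed.
Lemma coord_inj x y : co x =1 co y -> x = y.
Proof. by move=> e; rewrite (basisE x) (basisE y); under eq_bigr do rewrite e. Qed.
End Coordinates.
End Bases.

Section Tensor.
Variables (S : comNzRingType) (A B : comAlgType S) (n : nat).
Variables (b : 'I_n -> A) (co : A -> 'I_n -> S) (bco : is_basis b co).

Local Notation T := {ffun 'I_n -> B}.
(** A ⊗ B is modelled by n-tuples over [B], the tuple u standing for the sum of the [b i] ⊗ [u i];
    these are the structure constants of [A]. *)
Let c i j k : S := co (b i * b j) k.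
Let one : T := [ffun k => (co 1 k)%:A].
Let mul (u v : T) : T := [ffun k => \sum_i \sum_j c i j k *: (u i * v j)].
Let inl (a : A) : T := [ffun k => (co a k)%:A].
Let inr (x : B) : T := [ffun k => co 1 k *: x].

Let mulE u v k : mul u v k = \sum_i \sum_j c i j k *: (u i * v j).
Proof. by rewrite ffunE. Qed.

Let mul_inl a u k : mul (inl a) u k = \sum_j co (a * b j) k *: u j.
Proof.
rewrite ffunE exchange_big; apply: eq_bigr => j _ /=.
rewrite {2}(basisE bco a) mulr_suml (coord_sum bco) scaler_suml.
apply: eq_bigr => i _; rewrite ffunE mulr_algl scalerA -scalerAl (coordZ bco).
by rewrite mulrC.
Qed.

Let mulC : commutative mul.
Proof.
move=> u v; apply/ffunP => k; rewrite !ffunE exchange_big.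
apply: eq_bigr => i _; apply: eq_bigr => j _.
by rewrite /c (mulrC (b j)) (mulrC (u j)).
Qed.

Let mulA : associative mul.
Proof.
move=> u v w; apply/ffunP => m.
(* Both bracketings are reduced to this symmetric triple sum, where associativity is that of [A]. *)
have -> : mul u (mul v w) m =
    \sum_i \sum_j \sum_k co (b i * b j * b k) m *: (u i * v j * w k).
  rewrite mulE; apply: eq_bigr => i _.
  transitivity (\sum_l \sum_j \sum_k (c i l m * c j k l) *: (u i * v j * w k)).
    apply: eq_bigr => l _; rewrite mulE mulr_sumr scaler_sumr.
    apply: eq_bigr => j _; rewrite mulr_sumr scaler_sumr.
    by apply: eq_bigr => k _; rewrite -scalerAr scalerA mulrA.
  rewrite exchange_big; apply: eq_bigr => j _ /=.
  rewrite exchange_big; apply: eq_bigr => k _ /=.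
  rewrite -scaler_suml; congr (_ *: _).
  rewrite -mulrA [in RHS](basisE bco (b j * b k)) mulr_sumr (coord_sum bco).
  by apply: eq_bigr => l _; rewrite -scalerAr (coordZ bco) mulrC.
rewrite mulE; symmetry.
transitivity (\sum_l \sum_k \sum_i \sum_j (c l k m * c i j l) *: (u i * v j * w k)).
  apply: eq_bigr => l _; apply: eq_bigr => k _.
  rewrite mulE mulr_suml scaler_sumr; apply: eq_bigr => i _.
  rewrite mulr_suml scaler_sumr; apply: eq_bigr => j _.
  by rewrite -scalerAl scalerA.
rewrite exchange_big /=.
under eq_bigr do rewrite exchange_big /=.
under eq_bigr do under eq_bigr do rewrite exchange_big /=.
rewrite exchange_big /=; apply: eq_bigr => i _.
rewrite exchange_big /=; apply: eq_bigr => j _.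
apply: eq_bigr => k _.
rewrite -scaler_suml; congr (_ *: _).
rewrite [in RHS](basisE bco (b i * b j)) mulr_suml (coord_sum bco).
by apply: eq_bigr => l _; rewrite -scalerAl (coordZ bco) mulrC.
Qed.

Let mul1 : left_id one mul.
Proof.
move=> u; apply/ffunP => k; rewrite [LHS](mul_inl 1).
rewrite (bigD1 k) //= mul1r (coord_basis bco) eqxx scale1r big1 ?addr0 // => j.
by rewrite mul1r (coord_basis bco) eq_sym => /negbTE ->; rewrite scale0r.
Qed.

Let mulDl : left_distributive mul +%R.
Proof.
move=> u v w; apply/ffunP => k; rewrite !ffunE -big_split; apply: eq_bigr => i _.
rewrite -big_split; apply: eq_bigr => j _ /=.
by rewrite ffunE mulrDl scalerDr.
Qed.

Let oneN0 : one != 0.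
Proof.
apply/eqP => one0.
have u0 (u : T) : u = 0.
  rewrite -(mul1 u) one0; apply/ffunP => k; rewrite !ffunE big1 // => i _.
  by rewrite big1 // => j _; rewrite ffunE mul0r scaler0.
case: (posnP n) => [n0|n_gt0].
  have /eqP[] := oner_neq0 A; rewrite (basisE bco 1) big1 // => i.
  by exfalso; have := ltn_ord i; rewrite {2}n0.
have /eqP[] := oner_neq0 B.
by have /ffunP/(_ (Ordinal n_gt0)) := u0 [ffun => 1]; rewrite !ffunE.
Qed.

(** The proof of [is_basis] occurs in the type so that the ring axioms, which rest on it, can be
    supplied by inference. *)
Definition tensor_ring (_ : is_basis b co) : Type := T.
HB.instance Definition _ := GRing.Zmodule.on (tensor_ring bco).
HB.instance Definition _ := GRing.Zmodule_isComNzRing.Build (tensor_ring bco)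
  mulA mulC mul1 mulDl oneN0.

(** The two equations on [tc] say that the [i1 (b i)] form a basis of the tensor product over
    [B]. *)
Lemma tensor_exists : exists (Q : comAlgType S) (i1 : {lrmorphism A -> Q})
    (i2 : {lrmorphism B -> Q}) (tc : Q -> 'I_n -> B),
  (forall t, t = \sum_i i1 (b i) * i2 (tc t i)) /\
  (forall u i, tc (\sum_i i1 (b i) * i2 (u i)) i = u i).
Proof.
pose R' : comNzRingType := tensor_ring bco.
have inlD : {morph inl : x y / x + y}.
  by move=> x y; apply/ffunP => k; rewrite !ffunE (coordD bco) scalerDl.
have inrD : {morph inr : x y / x + y}.
  by move=> x y; apply/ffunP => k; rewrite !ffunE scalerDr.
have inlM : {morph inl : x y / x * y >-> mul x y}.
  move=> x y; apply/ffunP => k; rewrite mul_inl ffunE.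
  rewrite {1}(basisE bco y) mulr_sumr (coord_sum bco) scaler_suml.
  apply: eq_bigr => j _; rewrite ffunE scalerA -scalerAr (coordZ bco).
  by rewrite mulrC.
have inrE x k a : mul (inl a) (inr x) k = co a k *: x.
  rewrite mul_inl; under eq_bigr do rewrite ffunE scalerA.
  rewrite -scaler_suml; congr (_ *: _).
  rewrite -[in RHS](mulr1 a) [in RHS](basisE bco 1) mulr_sumr (coord_sum bco).
  by apply: eq_bigr => j _; rewrite -scalerAr (coordZ bco) mulrC.
have mul_inr x u k : mul (inr x) u k = x * u k.
  rewrite mulE exchange_big /=.
  transitivity (\sum_j co (1 * b j) k *: (x * u j)).
    apply: eq_bigr => j _; rewrite [in RHS](basisE bco 1) mulr_suml (coord_sum bco).
    rewrite scaler_suml; apply: eq_bigr => i _.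
    by rewrite ffunE -!scalerAl scalerA (coordZ bco) mulrC.
  rewrite (bigD1 k) //= mul1r (coord_basis bco) eqxx scale1r big1 ?addr0 // => j.
  by rewrite mul1r (coord_basis bco) eq_sym => /negbTE ->; rewrite scale0r.
have [f fE] := @rmorphism_of A R' inl inlD erefl inlM.
pose eta : {rmorphism S -> R'} := f \o in_alg A.
have etaE s : eta s = inl s%:A by rewrite -fE.
have [] := @lrmorphism_of S A (alg_of eta) inl inlD _ erefl inlM.
  by move=> s a; rewrite alg_ofZ etaE -[s *: a]mulr_algl inlM.
move=> i1 i1E.
have [] := @lrmorphism_of S B (alg_of eta) inr inrD _ _ _.
- move=> s x; rewrite alg_ofZ etaE; apply/ffunP => k.
  by rewrite [RHS]inrE ffunE (coordZ bco) !scalerA mulrC.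
- by apply/ffunP => k; rewrite !ffunE.
- move=> x y; apply/ffunP => k; rewrite [RHS]mul_inr !ffunE.
  by rewrite scalerAr.
move=> i2 i2E.
have tE (u : 'I_n -> B) : \sum_i i1 (b i) * i2 (u i) = [ffun i => u i] :> T.
  apply/ffunP => k; rewrite [LHS]sum_ffunE ffunE.
  rewrite (bigD1 k) //= i1E i2E inrE (coord_basis bco) eqxx scale1r.
  rewrite big1 ?addr0 // => j; rewrite i1E i2E inrE (coord_basis bco) eq_sym.
  by move/negbTE->; rewrite scale0r.
exists (alg_of eta), i1, i2, (fun t : T => fun i => t i); split=> [t|u i].
  by rewrite [RHS]tE; apply/ffunP => i; rewrite ffunE.
by rewrite [X in fun_of_fin X _]tE ffunE.
Qed.

End Tensor.

Lemma tensor_univ (S : comNzRingType) (A B C Q : comAlgType S) n (b : 'I_n -> A)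
    (co : A -> 'I_n -> S) (i1 : {lrmorphism A -> Q}) (i2 : {lrmorphism B -> Q}) tc
    (x : {lrmorphism A -> C}) (y : {lrmorphism B -> C}) :
    is_basis b co ->
    (forall t, t = \sum_i i1 (b i) * i2 (tc t i)) ->
    (forall u i, tc (\sum_i i1 (b i) * i2 (u i)) i = u i) ->
  exists z : {lrmorphism Q -> C}, lrcomp z i1 = x /\ lrcomp z i2 = y.
Proof.
move=> bco tcK Ktc.
pose f t := \sum_i x (b i) * y (tc t i).
have fE u : f (\sum_i i1 (b i) * i2 (u i)) = \sum_i x (b i) * y (u i).
  by apply: eq_bigr => i _; rewrite Ktc.
have fD : {morph f : s t / s + t}.
  move=> s t; rewrite {1}(tcK s) {1}(tcK t) -big_split /=.
  under eq_bigr do rewrite -mulrDr -lrmD.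
  rewrite fE -big_split; apply: eq_bigr => i _.
  by rewrite lrmD mulrDr.
have f_sum I (r : seq I) E : f (\sum_(i <- r) E i) = \sum_(i <- r) f (E i).
  elim: r => [|i r IH]; last by rewrite !big_cons fD IH.
  rewrite !big_nil; apply: (addrI (f 0)); rewrite -fD !addr0 //.
have fM12 a u : f (i1 a * i2 u) = x a * y u.
  rewrite (basisE bco a) (lrm_sum i1) mulr_suml.
  under eq_bigr do rewrite lrmZ -scalerAl scalerAr -lrmZ.
  rewrite fE (lrm_sum x) mulr_suml; apply: eq_bigr => i _.
  by rewrite !lrmZ -scalerAl -scalerAr.
have fM : {morph f : s t / s * t}.
  move=> s t; have -> : s * t =
      \sum_i \sum_j i1 (b i * b j) * i2 (tc s i * tc t j).
    rewrite {1}(tcK s) {1}(tcK t) mulr_suml; apply: eq_bigr => i _.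
    by rewrite mulr_sumr; apply: eq_bigr => j _; rewrite mulrACA -!lrmM.
  rewrite f_sum; under eq_bigr do rewrite f_sum.
  under eq_bigr do under eq_bigr do rewrite fM12 !lrmM mulrACA.
  by rewrite /f mulr_suml; apply: eq_bigr => i _; rewrite mulr_sumr.
have [] := @lrmorphism_of S Q C f fD _ _ fM.
- move=> s t; rewrite -[s *: t]mulr_algl fM -(lrm1 i1) -lrmZ.
  by rewrite -[i1 _]mulr1 -(lrm1 i2) fM12 lrmZ !lrm1 mulr1 mulr_algl.
- by rewrite -[1]mulr1 -{1}(lrm1 i1) -(lrm1 i2) fM12 !lrm1 mulr1.
move=> z zE; exists z; split; apply: lrmorphism_ext => a; rewrite lrcompE zE.
  by rewrite -[i1 a]mulr1 -(lrm1 i2) fM12 lrm1 mulr1.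
by rewrite -[i2 a]mul1r -(lrm1 i1) fM12 lrm1 mul1r.
Qed.

(** * Comultiplication and images *)

Section Comultiplication.
Variable S : comNzRingType.
Implicit Types (G : gscheme S) (A B C : comAlgType S).

(** The coproduct of [a] is the value at [a] of the sum of the two tautological points over G ⊗ G;
    any pair of points over [B] is an image of that pair. The left factors [l] are a basis, hence
    the same for all [a]. *)
Lemma comult G n : free_of_rank G n -> exists l : 'I_n -> G, forall a,
  exists r : 'I_n -> G, forall B (x y : gpoint G B),
    (x + y) a = \sum_i x (l i) * y (r i).
Proof.
move=> /free_of_rankP[b [co bco]].
have [Q [i1 [i2 [tc [tcK Ktc]]]]] := tensor_exists G bco.
exists b => a; exists (tc ((pmap i1 (idp G) + pmap i2 (idp G)) a)) => B x y.
have [z [zx zy]] := tensor_univ x y bco tcK Ktc.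
have -> : x + y = pmap z (pmap i1 (idp G) + pmap i2 (idp G)).
  by rewrite raddfD /= !pmap_comp zx zy !pmap_idp.
rewrite pmapE {1}(tcK (_ a)) lrm_sum; apply: eq_bigr => i _.
by rewrite lrmM -zx -zy !lrcompE.
Qed.

(** Subtracting its counit from an element subtracts its value at the zero point, so the centred
    products expand into the values of [a] at x + y, x + 0, 0 + y and 0 + 0. *)
Lemma comult_aug G n a : free_of_rank G n -> eps G a = 0 ->
  exists l r : 'I_n -> G,
    (forall i, eps G (l i) = 0 /\ eps G (r i) = 0) /\
    forall B (x y : gpoint G B), (x + y) a = x a + y a + \sum_i x (l i) * y (r i).
Proof.
move=> /comult[l /(_ a)[r rE]] a0.
pose c (u : G) : G := u - (eps G u)%:A.
exists (c \o l), (c \o r); split=> [i|B x y].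
  by rewrite /= /c !eps_sub.
have xE (z : gpoint G B) u : z (c u) = z u - (0 : gpoint G B) u.
  by rewrite lrmB lrmZ lrm1 zero_pointE.
under eq_bigr do rewrite /= !xE mulrBl !mulrBr.
rewrite 2!sumrB -!rE sumrB -rE -rE addr0 add0r addr0 zero_pointE a0 scale0r subr0.
by rewrite -(addrA _ (- x a)) -opprD [RHS]addrC subrK.
Qed.

(* The schematic image of psi is the closed subscheme of G2 cut out by the kernel
   of psi; it is stable under addition because Q (x) Q embeds into G' (x) G'. *)
Section Image.
Variables (G' G2 : gscheme S) (psi : ghom G' G2) (Q : comAlgType S) (m n : nat).
Variable pi : {lrmorphism G2 -> Q}.
Hypothesis piS : forall q, exists x, pi x = q.
Hypothesis piK : forall x, pi x = 0 <-> gh_alg psi x = 0.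
Hypothesis (Qfree : free_of_rank Q m) (Gfree : free_of_rank G' n).
Hypothesis G2free : finite_flat G2.

(** The points of [G2] that factor through the image [Q]. *)
Let pidom B (x : gpoint G2 B) := forall a, gh_alg psi a = 0 -> x a = 0.

Let pidom_pi B (z : {lrmorphism Q -> B}) : pidom (lrcomp z pi).
Proof. by move=> a /piK ae; rewrite lrcompE ae lrm0. Qed.

(** Injectivity of Q ⊗ Q into G' ⊗ G', checked one factor at a time: the coordinates along the [b l]
    in the left factor give relations between the [u j], and their vanishing gives relations between
    the [u i]. *)
Lemma tensor_coef0 (u : 'I_m -> G') C (i1 i2 : {lrmorphism G' -> C}) tc
    (b : 'I_n -> G') co (k : 'I_m -> 'I_m -> S) :
    is_basis b co ->
    (forall v i, tc (\sum_i i1 (b i) * i2 (v i)) i = v i :> G') ->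
    (forall c : 'I_m -> S, \sum_i c i *: u i = 0 -> forall i, c i = 0) ->
    \sum_i \sum_j k i j *: (i1 (u i) * i2 (u j)) = 0 -> forall i j, k i j = 0.
Proof.
move=> bco Ktc ufree e0.
have e1 l : \sum_j (\sum_i k i j * co (u i) l) *: u j = 0.
  have := Ktc (fun l => \sum_j (\sum_i k i j * co (u i) l) *: u j) l => <-.
  have -> : \sum_l i1 (b l) * i2 (\sum_j (\sum_i k i j * co (u i) l) *: u j) = 0.
    rewrite -[RHS]e0 exchange_big /=.
    under eq_bigr do rewrite (lrm_sum i2) mulr_sumr.
    rewrite exchange_big; apply: eq_bigr => j _ /=.
    under eq_bigr do rewrite lrmZ scaler_suml mulr_sumr.
    rewrite exchange_big; apply: eq_bigr => i _ /=.
    rewrite {2}(basisE bco (u i)) (lrm_sum i1) mulr_suml scaler_sumr.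
    apply: eq_bigr => l' _; rewrite lrmZ -scalerAl -scalerAr scalerA.
    by [].
  have := Ktc (fun=> 0) l; rewrite big1 => [-> //|i _].
  by rewrite lrm0 mulr0.
move=> i j; apply: (ufree (k^~ j)).
apply: (coord_inj bco) => l; rewrite (coord0 bco) (coord_sum bco).
by under eq_bigr do rewrite (coordZ bco); apply: (ufree _ (e1 l)).
Qed.

Let pidomD B (x y : gpoint G2 B) : pidom x -> pidom y -> pidom (x + y).
Proof.
have [n2 /comult[l lP]] := G2free.
move=> x0 y0 a a0; have [r rE] := lP a; rewrite rE.
have [b [co bco]] := (free_of_rankP _ _).1 Gfree.
have [T [i1 [i2 [tc [tcK Ktc]]]]] := tensor_exists G' bco.
have [w [cw wcw]] := (free_of_rankP _ _).1 Qfree.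
have [v vE] := choice (fun i => piS (w i)).
have red C (z : gpoint G2 C) : pidom z ->
    forall c, z c = \sum_i cw (pi c) i *: z (v i).
  move=> z0 c; apply/eqP; rewrite -subr_eq0.
  under eq_bigr do rewrite -lrmZ; rewrite -lrm_sum -lrmB; apply/eqP/z0/piK.
  rewrite lrmB lrm_sum {1}(basisE wcw (pi c)); apply/eqP; rewrite subr_eq0.
  by apply/eqP; apply: eq_bigr => i _; rewrite lrmZ vE.
(* The coproduct of [a] in a basis of Q ⊗ Q. It does not depend on the points, so its vanishing can
   be tested on [j1] and [j2] over G' ⊗ G', whose sum factors through [psi] and therefore kills
   [a]. *)
pose k i j := \sum_s cw (pi (l s)) i * cw (pi (r s)) j.
have sumE C (z t : gpoint G2 C) : pidom z -> pidom t ->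
    \sum_s z (l s) * t (r s) = \sum_i \sum_j k i j *: (z (v i) * t (v j)).
  move=> z0 t0.
  under eq_bigr do rewrite (red _ z z0 (l _)) (red _ t t0 (r _)) mulr_suml.
  rewrite exchange_big; apply: eq_bigr => i _ /=.
  under eq_bigr do rewrite mulr_sumr.
  rewrite exchange_big; apply: eq_bigr => j _ /=.
  rewrite scaler_suml; apply: eq_bigr => s _.
  by rewrite -scalerAl -scalerAr scalerA.
rewrite sumE // big1 // => i _; rewrite big1 // => j _.
suff -> : k i j = 0 by rewrite scale0r.
apply: (tensor_coef0 (u := fun i => gh_alg psi (v i)) (i1 := i1) (i2 := i2) bco Ktc).
  move=> c c0 i'; rewrite -(coordE wcw c).
  suff -> : \sum_i c i *: w i = 0 by rewrite (coord0 wcw).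
  have -> : \sum_i c i *: w i = pi (\sum_i c i *: v i).
    by rewrite lrm_sum; apply: eq_bigr => s _; rewrite lrmZ vE.
  by apply/piK; rewrite lrm_sum -[RHS]c0; apply: eq_bigr => s _; rewrite lrmZ.
pose j1 : gpoint G2 T := hmap psi (pmap i1 (idp G')).
pose j2 : gpoint G2 T := hmap psi (pmap i2 (idp G')).
have d1 : pidom j1 by move=> c c0; rewrite hmapE pmapE c0 lrm0.
have d2 : pidom j2 by move=> c c0; rewrite hmapE pmapE c0 lrm0.
rewrite -[LHS](sumE _ j1 j2 d1 d2) -rE -raddfD hmapE a0.
exact: lrm0.
Qed.

Let pidomN B (x : gpoint G2 B) : pidom x -> pidom (- x).
Proof.
move=> x0 a a0; have -> : - x = pmap x (- idp G2) by rewrite raddfN /= pmap_idp.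
rewrite pmapE; apply: x0.
have <- : hmap psi (- idp G') a = gh_alg psi ((- idp G2) a).
  rewrite -pmapE !raddfN /=; congr ((- _ : gpoint G2 G') a).
  exact: lrmorphism_ext.
by rewrite hmapE a0 lrm0.
Qed.

Let pidom0 B : pidom (0 : gpoint G2 B).
Proof. by rewrite -(raddf0 (@hmap _ _ _ psi B)) => a a0; rewrite hmapE a0 lrm0. Qed.

Let lift B (x : gpoint G2 B) : pidom x -> {z : {lrmorphism Q -> B} | lrcomp z pi = x}.
Proof.
move=> x0; apply: cid; apply: factor_lrmorphism => // a /piK; exact: x0.
Qed.

Let qadd B (x y : {lrmorphism Q -> B}) : {lrmorphism Q -> B} :=
  sval (lift (pidomD (pidom_pi x) (pidom_pi y))).
Let qopp B (x : {lrmorphism Q -> B}) : {lrmorphism Q -> B} :=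
  sval (lift (pidomN (pidom_pi x))).
Let qzero B : {lrmorphism Q -> B} := sval (lift (@pidom0 B)).

Let pr B (x : {lrmorphism Q -> B}) : gpoint G2 B := lrcomp x pi.
Let qaddE B x y : pr (@qadd B x y) = pr x + pr y.
Proof. exact: (svalP (lift _)). Qed.
Let qoppE B x : pr (@qopp B x) = - pr x.
Proof. exact: (svalP (lift _)). Qed.
Let qzeroE B : pr (@qzero B) = 0.
Proof. exact: (svalP (lift _)). Qed.
Let prI B (x y : {lrmorphism Q -> B}) : pr x = pr y -> x = y.
Proof. exact: lrcomp_surj_inj. Qed.

Lemma image_subgroup : exists (G'' : gscheme S) (iota : ghom G'' G2)
    (phi : {lrmorphism G'' -> G'}),
  [/\ closed_immersion iota, free_of_rank G'' m, injective phi &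
      forall a, phi (gh_alg iota a) = gh_alg psi a].
Proof.
have addA B : associative (@qadd B).
  by move=> x y z; apply: prI; rewrite !qaddE addrA.
have addC B : commutative (@qadd B).
  by move=> x y; apply: prI; rewrite !qaddE addrC.
have add0 B : left_id (@qzero B) (@qadd B).
  by move=> x; apply: prI; rewrite qaddE qzeroE add0r.
have addN B : left_inverse (@qzero B) (@qopp B) (@qadd B).
  by move=> x; apply: prI; rewrite qaddE qoppE qzeroE addNr.
have nat B C (h : {lrmorphism B -> C}) x y :
    lrcomp h (qadd x y) = qadd (lrcomp h x) (lrcomp h y).
  apply: prI; rewrite qaddE /pr -!lrcompA -/(pr _) -/(pr x) -/(pr y) qaddE.
  exact: (raddfD (@pmap _ G2 B C h)).
pose G'' := GScheme addA addC add0 addN nat.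
have ihom B (x y : Defs.point G'' B) : lrcomp (gs_add x y) pi =
    gs_add (lrcomp x pi) (lrcomp y pi) by apply: qaddE.
pose iota : ghom G'' G2 := GHom ihom.
have [phi phiE] := factor_lrmorphism piS (fun a => (piK a).1).
exists G'', iota, phi; split=> //.
  move=> x y; have [x' <-] := piS x; have [y' <-] := piS y => e.
  apply/eqP; rewrite -subr_eq0 -lrmB; apply/eqP/piK; rewrite lrmB.
  apply/eqP; rewrite subr_eq0; apply/eqP.
  by have := e; rewrite -!lrcompE phiE.
by move=> a; rewrite -phiE.
Qed.

End Image.
End Comultiplication.

(** * The cotangent space *)

Section Cotangent.
Variable S : comNzRingType.
Implicit Types (G : gscheme S) (A B C : comAlgType S).

Section SquareIdeal.
Variable G : gscheme S.
Local Notation Isq := (@aug_ideal_sq S G).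

Lemma aug_sqM y z : eps G y = 0 -> eps G z = 0 -> Isq (y * z).
Proof.
move=> y0 z0; exists 1%N, (fun=> y), (fun=> z); split=> //.
by rewrite big_ord1.
Qed.

Lemma aug_sq0 : Isq 0.
Proof. by rewrite -(mulr0 0); apply: aug_sqM; apply: lrm0. Qed.

Lemma aug_sqD x y : Isq x -> Isq y -> Isq (x + y).
Proof.
move=> [m [a [b [ab ->]]]] [n [c [d [cd ->]]]].
exists (m + n)%N, (fun i => match fintype.split i with inl i => a i | inr i => c i end).
exists (fun i => match fintype.split i with inl i => b i | inr i => d i end); split.
  by move=> j; case: splitP => k _.
rewrite big_split_ord; congr (_ + _); apply: eq_bigr => i _.
  by rewrite (unsplitK (inl _ i)).
by rewrite (unsplitK (inr _ i)).
Qed.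

Lemma aug_sqMr r x : Isq x -> Isq (r * x).
Proof.
move=> [m [a [b [ab ->]]]]; exists m, (fun i => r * a i), b; split.
  by move=> j; have [a0 b0] := ab j; split=> //; rewrite aug_idealE lrmM
    [eps G (a j)]a0 mulr0.
by rewrite mulr_sumr; under eq_bigr do rewrite mulrA.
Qed.

Lemma aug_sqZ s x : Isq x -> Isq (s *: x).
Proof. by rewrite -mulr_algl; apply: aug_sqMr. Qed.

Lemma aug_sqN x : Isq x -> Isq (- x).
Proof. by rewrite -scaleN1r; apply: aug_sqZ. Qed.

Lemma aug_sqMn n x : Isq x -> Isq (x *+ n).
Proof. by rewrite -scaler_nat; apply: aug_sqZ. Qed.

Lemma aug_sq_sum I (r : seq I) (P : pred I) F :
  (forall i, P i -> Isq (F i)) -> Isq (\sum_(i <- r | P i) F i).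
Proof. by move=> FI; apply: big_ind => //; [apply: aug_sq0 | apply: aug_sqD]. Qed.

Lemma aug_sq_trans y x z : Isq (x - y) -> Isq (y - z) -> Isq (x - z).
Proof. by move=> xy yz; rewrite -(subrK y x) -addrA; apply: aug_sqD. Qed.

Lemma aug_sq_aug x : Isq x -> eps G x = 0.
Proof.
move=> [m [a [b [ab ->]]]]; rewrite lrm_sum big1 // => i _.
by have [a0 b0] := ab i; rewrite lrmM [eps G (a i)]a0 mul0r.
Qed.

End SquareIdeal.

Lemma aug_sq_hom (G1 G2 : gscheme S) (f : {lrmorphism G2 -> G1}) x :
  (forall y, eps G2 y = 0 -> eps G1 (f y) = 0) ->
  aug_ideal_sq x -> aug_ideal_sq (f x).
Proof.
move=> fI [m [a [b [ab ->]]]]; rewrite lrm_sum; apply: aug_sq_sum => i _.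
by rewrite lrmM; have [a0 b0] := ab i; apply: aug_sqM; apply: fI.
Qed.

Lemma eps_mulrn G n a : eps G a = 0 -> eps G ((idp G *+ n) a) = 0.
Proof.
move=> a0; rewrite -pmapE raddfMn /= pmap_idp.
rewrite [_ *+ n](_ : _ = eps G); first exact: a0.
exact: (mul0rn (gpoint G S^o)).
Qed.

(** The differential of [n] is n: in the coproduct of an element of the augmentation ideal, the
    terms beyond x + y are products of two such elements. *)
Lemma mulrn_aug G n a : finite_flat G -> eps G a = 0 ->
  aug_ideal_sq ((idp G *+ n) a - a *+ n).
Proof.
move=> [d Gfree]; elim: n a => [|n IH] a a0.
  by rewrite !mulr0n zero_pointE a0 scale0r subrr; apply: aug_sq0.
have [l [r [lr0 lrE]]] := comult_aug Gfree a0.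
rewrite mulrS lrE mulrS opprD -[X in X + _]addrA addrACA subrr add0r addrAC.
apply: aug_sqD; first exact: IH.
by apply: aug_sq_sum => i _; have [? ?] := lr0 i; apply: aug_sqM => //; apply: eps_mulrn.
Qed.

Definition killed_by n G := forall B (x : gpoint G B), x *+ n = 0.

Lemma killed_aug G n a : finite_flat G -> killed_by n G -> eps G a = 0 ->
  aug_ideal_sq (a *+ n).
Proof.
move=> Gff Gn a0; rewrite -[a *+ n]opprK; apply: aug_sqN.
have := mulrn_aug n Gff a0; rewrite Gn zero_pointE a0 scale0r.
by rewrite sub0r.
Qed.

Lemma aug_decomp G a : exists2 a' : G, eps G a' = 0 & a = (eps G a)%:A + a'.
Proof.
exists (a - (eps G a)%:A); first exact: eps_sub.
by rewrite addrC subrK.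
Qed.

(** An element r of [G] acts on I / I^2 through the scalar eps r, so an [S]-submodule of I / I^2
    pulls back to an ideal of [G]. *)
Lemma aug_coset_ideal G (P : set G) :
  P 0 -> (forall x y, P x -> P y -> P (x + y)) -> (forall s x, P x -> P (s *: x)) ->
  (forall x, P x -> eps G x = 0) ->
  ideal [set x | exists2 t, P t & aug_ideal_sq (x - t)].
Proof.
move=> P0 PD PZ PI; split=> /=.
- by exists 0; rewrite // subr0; apply: aug_sq0.
- move=> x y [t Pt xt] [u Pu yu]; exists (t + u); first exact: PD.
  by rewrite opprD addrACA; apply: aug_sqD.
move=> r x [t Pt xt]; have [r' r'0 ->] := aug_decomp r.
exists (eps G r *: t); first exact: PZ.
have x0 : eps G x = 0.
  by rewrite -(subrK t x) lrmD (aug_sq_aug xt) PI // addr0.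
rewrite mulrDl mulr_algl addrAC -scalerBr.
by apply: aug_sqD; [apply: aug_sqZ | apply: aug_sqM].
Qed.

Lemma coset_ideal_proper G (P : set G) : (forall x, P x -> eps G x = 0) ->
  ~ [set x | exists2 t, P t & aug_ideal_sq (x - t)]%classic 1.
Proof.
move=> PI [t Pt /aug_sq_aug]; rewrite lrmB lrm1 (PI t Pt) subr0.
by apply/eqP; exact: oner_neq0.
Qed.

Lemma point_eq0 G B (x : gpoint G B) : (forall a, eps G a = 0 -> x a = 0) -> x = 0.
Proof.
move=> xI; apply: point_ext => a; have [a' a'0 ->] := aug_decomp a.
rewrite !lrmD (xI a') // addr0 lrmZ lrm1 [_ a']zero_pointE a'0 scale0r addr0.
by rewrite lrmZ lrm1.
Qed.

(* phi vanishes on the universal point of the quotient by phi^* I2 + I1^2. *)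
Lemma kernel_aug (G1 G2 : gscheme S) (phi : ghom G1 G2) M :
  finite_flat G1 ->
  (forall B (x : gpoint G1 B), hmap phi x = 0 -> x *+ M = 0) ->
  forall a, eps G1 a = 0 ->
    exists2 t, eps G2 t = 0 & aug_ideal_sq (a *+ M - gh_alg phi t).
Proof.
move=> G1ff phiM a a0.
pose P : set G1 := [set x | exists2 t, eps G2 t = 0 & x = gh_alg phi t]%classic.
have PI x : P x -> eps G1 x = 0 by move=> [t t0 ->]; rewrite eps_hom.
have Jid : ideal [set x | exists2 t, P t & aug_ideal_sq (x - t)]%classic.
  apply: aug_coset_ideal => //.
  - by exists 0; rewrite lrm0.
  - move=> _ _ [t t0 ->] [u u0 ->]; exists (t + u); last by rewrite lrmD.
    by rewrite lrmD t0 u0 addr0.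
  - move=> s _ [t t0 ->]; exists (s *: t); last by rewrite lrmZ.
    by rewrite lrmZ t0 scaler0.
have [Q [q [_ qK]]] := quotient_lalg Jid (coset_ideal_proper PI).
have qM : (q : gpoint G1 Q) *+ M = 0.
  apply: phiM; apply: point_eq0 => b b0; rewrite hmapE; apply/qK.
  exists (gh_alg phi b); first by exists b.
  by rewrite subrr; apply: aug_sq0.
have : q ((idp G1 *+ M) a) = 0.
  rewrite -pmapE raddfMn /= pmap_idp qM.
  by rewrite [LHS]zero_pointE a0 scale0r.
move=> /qK[_ [t t0 ->] tE]; exists t => //.
apply: aug_sq_trans tE; rewrite -opprB; apply: aug_sqN.
exact: mulrn_aug.
Qed.

Section KernelInclusion.
Variables (G1 G2 : gscheme S) (i : ghom G1 G2) (M : nat).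
Hypothesis iI : forall B, injective (@hmap S _ _ i B).
Hypothesis iM : forall B (x : gpoint G2 B), x *+ M = 0 <-> exists y, hmap i y = x.
Hypothesis G2ff : finite_flat G2.

(** The ideal generated by the pullback of the augmentation ideal under [M]; it cuts out the
    [M]-torsion. *)
Let J : set G2 := [set x | forall L : set G2, ideal L ->
  (forall a, eps G2 a = 0 -> L ((idp G2 *+ M) a)) -> L x]%classic.

(** The tautological point [q] of G2 / J is killed by [M], so it factors as [y] after [gh_alg i];
    this bounds the kernel of [gh_alg i] by [J]. The map [j] back to [G1] satisfies [j] ∘ [y] = id
    because [i] is injective on points, which gives surjectivity. *)
Let ker_sub : (forall b, exists a, gh_alg i a = b) /\
  (forall a, gh_alg i a = 0 -> J a).
Proof.
have Jid : ideal J.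
  split=> [L [] //|x y Jx Jy L Lid LI|r x Jx L Lid LI].
    by have [_ LD _] := Lid; apply: LD; [apply: Jx | apply: Jy].
  by have [_ _ LM] := Lid; apply: LM; apply: Jx.
have J1 : ~ J 1.
  move=> /(_ _ (ker_ideal (eps G2)) (@eps_mulrn G2 M)) /=.
  by rewrite lrm1; apply/eqP; exact: oner_neq0.
have [Q [q [qS qK]]] := quotient_lalg Jid J1.
have /iM[y yE] : (q : gpoint G2 Q) *+ M = 0.
  apply: point_eq0 => b b0; rewrite -(pmap_idp (q : gpoint G2 Q)) -raddfMn pmapE.
  by apply/qK => L _; apply.
have idK : forall a, q a = 0 -> gh_alg i a = 0.
  move=> a /qK/(_ _ (ker_ideal (gh_alg i))); apply=> b b0 /=.
  rewrite -pmapE raddfMn /= pmap_idp.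
  have -> : (gh_alg i : gpoint G2 G1) *+ M = 0.
    by apply/iM; exists (idp G1); apply: lrmorphism_ext.
  by rewrite zero_pointE b0 scale0r.
have [j jE] := factor_lrmorphism qS idK.
have jy : pmap j y = idp G1.
  apply: iI; rewrite -pmap_hmap; apply: lrmorphism_ext => a.
  by rewrite pmapE yE -lrcompE jE.
split=> [b|a a0].
  have [a qa] := qS (y b); exists a; rewrite -jE lrcompE qa -pmapE jy //.
by apply/qK; rewrite -yE hmapE a0 lrm0.
Qed.

Lemma kernel_incl_surj b : exists a, gh_alg i a = b.
Proof. exact: ker_sub.1. Qed.

(** This is the equality of omega of the [M]-torsion with omega of [G2] modulo [M]: the equations in
    [J] are multiples of [M] modulo the squared augmentation ideal. *)
Lemma kernel_incl_aug x : aug_ideal_sq (gh_alg i x) ->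
  exists2 z, eps G2 z = 0 & aug_ideal_sq (x - z *+ M).
Proof.
move=> [m [u [v [uv xE]]]].
have [u' u'E] := choice (fun k => kernel_incl_surj (u k)).
have [v' v'E] := choice (fun k => kernel_incl_surj (v k)).
have Jx : J (x - \sum_k u' k * v' k).
  apply: ker_sub.2; rewrite lrmB xE lrm_sum; apply/eqP; rewrite subr_eq0.
  by apply/eqP; apply: eq_bigr => k _; rewrite lrmM u'E v'E.
pose P : set G2 := [set x | exists2 t, eps G2 t = 0 & x = t *+ M]%classic.
have PI t : P t -> eps G2 t = 0 by move=> [z z0 ->]; rewrite lrmMn z0 mul0rn.
have [] := Jx [set x | exists2 t, P t & aug_ideal_sq (x - t)]%classic.
- apply: aug_coset_ideal => //.
  + by exists 0; rewrite ?lrm0 ?mul0rn.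
  + move=> _ _ [t t0 ->] [w w0 ->]; exists (t + w); last by rewrite mulrnDl.
    by rewrite lrmD t0 w0 addr0.
  + move=> s _ [t t0 ->]; exists (s *: t); last by rewrite scalerMnr.
    by rewrite lrmZ t0 scaler0.
- move=> a a0; exists (a *+ M); first by exists a.
  exact: mulrn_aug.
move=> _ [z z0 ->] zE; exists z => //.
apply: aug_sq_trans; last exact: zE.
rewrite opprB addrC subrK; apply: aug_sq_sum => k _.
have [uk vk] := uv k.
by apply: aug_sqM; rewrite -(eps_hom i) ?u'E ?v'E.
Qed.

End KernelInclusion.

Definition cotangent_gens G d (u : 'I_d -> G) :=
  (forall k, eps G (u k) = 0) /\
  forall x, eps G x = 0 -> exists c : 'I_d -> S, aug_ideal_sq (x - \sum_k c k *: u k).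

Lemma aug_basis G d (b : 'I_d -> G) co x : is_basis b co ->
  \sum_k co x k *: (b k - (eps G (b k))%:A) = x - (eps G x)%:A.
Proof.
move=> bco; under eq_bigr do rewrite scalerBr scalerA.
rewrite sumrB -(basisE bco) -scaler_suml; congr (_ - _%:A).
by rewrite {2}(basisE bco x) lrm_sum; apply: eq_bigr => k _; rewrite lrmZ.
Qed.

Lemma cotangent_gens_basis G d : free_of_rank G d ->
  exists u : 'I_d -> G, cotangent_gens u.
Proof.
move=> /free_of_rankP[b [co bco]]; exists (fun k => b k - (eps G (b k))%:A).
split=> [k|x x0]; first exact: eps_sub.
by exists (co x); rewrite (aug_basis _ bco) x0 scale0r subr0 subrr; apply: aug_sq0.
Qed.

(** Nakayama for a nilpotent multiplier: lifted generators span omega modulo [M]; applying this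
    again to the remainder leaves an error in M^2 omega, which is zero. *)
Lemma cotangent_gens_lift (G1 G2 : gscheme S) (i : ghom G1 G2) M d (u : 'I_d -> G1) :
  (forall B, injective (@hmap S _ _ i B)) ->
  (forall B (x : gpoint G2 B), x *+ M = 0 <-> exists y, hmap i y = x) ->
  finite_flat G2 -> killed_by (M * M) G2 ->
  cotangent_gens u -> exists u' : 'I_d -> G2, cotangent_gens u'.
Proof.
move=> iI iM G2ff G2M [u0 uP].
have [u' u'E] := choice (fun k => kernel_incl_surj iI iM (u k)).
exists u'; split=> [k|x x0]; first by rewrite -(eps_hom i) u'E.
have step y : eps G2 y = 0 -> exists c z, eps G2 z = 0 /\
    aug_ideal_sq (y - \sum_k c k *: u' k - z *+ M).
  move=> y0; have [|c cE] := uP (gh_alg i y); first by rewrite eps_hom.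
  have [|z z0 zE] := @kernel_incl_aug _ _ i M iI iM G2ff (y - \sum_k c k *: u' k).
    rewrite lrmB lrm_sum; under eq_bigr do rewrite lrmZ u'E.
    exact: cE.
  by exists c, z.
have [c [z [z0 zE]]] := step x x0.
have [c' [z' [z'0 z'E]]] := step z z0.
exists (fun k => c k + M%:R * c' k).
under eq_bigr do rewrite scalerDl -scalerA.
rewrite big_split /= -scaler_sumr opprD addrA scaler_nat.
have -> : x - \sum_k c k *: u' k - (\sum_k c' k *: u' k) *+ M =
   (x - \sum_k c k *: u' k - z *+ M) + (z - \sum_k c' k *: u' k - z' *+ M) *+ M
   + z' *+ (M * M).
  by rewrite !mulrnBl -mulrnA -[RHS]addrA subrK subrKA.
apply: aug_sqD; last exact: killed_aug.
by apply: aug_sqD => //; apply: aug_sqMn.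
Qed.

End Cotangent.

(** * Fitting ideals and Smith normal form *)

Section Fitting.
Variables (S : comNzRingType) (V : lmodType S) (N : V -> Prop).
Hypotheses (N0 : N 0) (ND : forall x y, N x -> N y -> N (x + y)).
Hypothesis NZ : forall s x, N x -> N (s *: x).

Let Nsum I (r : seq I) F : (forall i, N (F i)) -> N (\sum_(i <- r) F i).
Proof. by move=> NF; apply: big_ind. Qed.

(* With B = diag b, the relations X P = Y B and 1 - Q P = Z B give
   [X, 0; -Q, 1] [1, P; 0, 1] = [X, Y; -Q, Z] [1, 0; 0, B]. *)
Lemma fitting_det r s (w : 'I_r -> V) (b : 'I_r -> S) (g : 'I_s -> V)
    (P : 'M[S]_(s, r)) (Q : 'M[S]_(r, s)) (X : 'M[S]_s) :
  (forall c, N (\sum_j c j *: w j) -> forall j, exists z, c j = b j * z) ->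
  (forall i, N (g i - \sum_j P i j *: w j)) ->
  (forall j, N (w j - \sum_i Q j i *: g i)) ->
  (forall i, N (\sum_j X i j *: g j)) ->
  exists z, \det X = z * \prod_j b j.
Proof.
move=> wb gP wQ Xg.
have sumP k (M : 'M[S]_(k, s)) i :
    N (\sum_j M i j *: g j - \sum_l (M *m P) i l *: w l).
  rewrite (_ : _ - _ = \sum_j M i j *: (g j - \sum_l P j l *: w l)).
    by apply: Nsum => j; apply: NZ.
  under [in RHS]eq_bigr do rewrite scalerBr.
  rewrite sumrB; congr (_ - _).
  under [in RHS]eq_bigr do rewrite scaler_sumr.
  rewrite exchange_big; apply: eq_bigr => l _ /=.
  by rewrite mxE scaler_suml; apply: eq_bigr => j _; rewrite scalerA.
have NB x y : N x -> N y -> N (x - y).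
  by move=> Nx Ny; apply: ND => //; rewrite -scaleN1r; apply: NZ.
have /choice[Y YE] i : exists y : 'I_r -> S, forall l, (X *m P) i l = b l * y l.
  suff H : N (\sum_l (X *m P) i l *: w l) by have [y yE] := choice (wb _ H); exists y.
  rewrite -[\sum_l _](subKr (\sum_j X i j *: g j)); exact: NB.
have /choice[Z ZE] j : exists z : 'I_r -> S, forall l, (1%:M - Q *m P) j l = b l * z l.
  suff H : N (\sum_l (1%:M - Q *m P) j l *: w l).
    by have [y yE] := choice (wb _ H); exists y.
  rewrite (_ : \sum_l _ = (w j - \sum_i Q j i *: g i)
      + (\sum_i Q j i *: g i - \sum_l (Q *m P) j l *: w l)).
    exact: ND.
  rewrite subrKA; under eq_bigr do rewrite !mxE scalerBl.
  rewrite sumrB; congr (_ - _); last by apply: eq_bigr => i _; rewrite mxE.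
  rewrite (bigD1 j) //= eqxx scale1r big1 ?addr0 // => i.
  by rewrite eq_sym => /negbTE->; rewrite scale0r.
pose d := \row_j b j.
have YE' : X *m P = (\matrix_(i, l) Y i l) *m diag_mx d.
  by rewrite mul_mx_diag; apply/matrixP => i l; rewrite YE !mxE mulrC.
have ZE' : 1%:M - Q *m P = (\matrix_(i, l) Z i l) *m diag_mx d.
  by rewrite mul_mx_diag; apply/matrixP => i l; rewrite ZE !mxE mulrC.
pose M := block_mx X (\matrix_(i, l) Y i l) (- Q) (\matrix_(i, l) Z i l).
exists (\det M).
have -> : \prod_j b j = \det (block_mx (1%:M : 'M[S]_s) 0 0 (diag_mx d)).
  rewrite det_ublock det1 mul1r det_diag; apply: eq_bigr => i _.
  by rewrite mxE.
rewrite -det_mulmx mulmx_block !mulmx1 !mulmx0 !addr0 !add0r -YE' -ZE'.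
have -> : block_mx X (X *m P) (- Q) (1%:M - Q *m P) =
    block_mx X 0 (- Q) 1%:M *m block_mx 1%:M P 0 1%:M.
  rewrite mulmx_block !mulmx1 !mulmx0 !addr0 mulNmx.
  by rewrite [_ + 1%:M]addrC.
by rewrite det_mulmx det_lblock det_ublock !det1 !mulr1.
Qed.
End Fitting.

Section Smith.
Variable S : comNzRingType.
Hypothesis div_total : forall x y : S, (exists z, y = z * x) \/ (exists z, x = z * y).

Lemma min_div (I : finType) (i0 : I) (f : I -> S) :
  exists i, forall j, exists z, f j = z * f i.
Proof.
suff [i iP] : exists i, forall j, j \in enum I -> exists z, f j = z * f i.
  by exists i => j; apply: iP; rewrite mem_enum.
elim: (enum I) => [|k s [i iP]]; first by exists i0.
have [[z zE]|[z zE]] := div_total (f i) (f k).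
  exists i => j; rewrite inE => /orP[/eqP->|/iP //].
  by exists z.
exists k => j; rewrite inE => /orP[/eqP->|/iP[t ->]].
  by exists 1; rewrite mul1r.
by exists (t * z); rewrite zE mulrA.
Qed.

(** Only the row space matters for a module presented by [X], so the column change [P] is recorded
    and row operations are absorbed in the equality of row spaces. The diagonal has length [m], with
    zero entries where the rank falls short. *)
Definition smith_form m s (X : 'M[S]_(s, m)) := exists (P P' : 'M[S]_m) (a : 'rV[S]_m),
  [/\ P *m P' = 1%:M, P' *m P = 1%:M & forall c : 'rV[S]_m,
    (exists y, c = y *m X) <-> exists e, c *m P = e *m diag_mx a].

Lemma smith_step m s (X : 'M[S]_(s.+1, 1 + m)) :
  (forall Y : 'M[S]_(s.+1, m), smith_form Y) -> smith_form X.
Proof.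
move=> IH.
have [[k i] kiP] := @min_div ('I_s.+1 * 'I_m.+1)%type (ord0, ord0) (fun u => X u.1 u.2).
pose T : 'M[S]_(1 + m) := @tperm_mx S m.+1 ord0 i.
have TT : T *m T = 1%:M by rewrite /T /tperm_mx -perm_mxM tperm2 perm_mx1.
pose X1 : 'M[S]_(s.+1, 1 + m) := X *m T.
pose x := lsubmx X1; pose Y := rsubmx X1.
have XE : X *m T = row_mx x Y by rewrite hsubmxK.
have X1E u j : X1 u j = X u (tperm ord0 i j).
  by rewrite /X1 /T /tperm_mx -{1}[tperm _ _]tpermV -col_permE mxE.
pose al := X k i.
have xk : x k 0 = al.
  rewrite mxE X1E; have -> : lshift m (0 : 'I_1) = (ord0 : 'I_m.+1) by exact: val_inj.
  by rewrite tpermL.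
have [t' t'E] : exists t' : 'cV[S]_(s.+1), x = al *: t' /\ t' k 0 = 1.
  have /choice[t tE] u : exists z, x u 0 = z * al.
    by rewrite mxE X1E; apply: (kiP (u, _)).
  exists (\col_u (if u == k then 1 else t u)); split; last by rewrite mxE eqxx.
  apply/colP => u; rewrite [RHS]mxE [_ u 0 in RHS]mxE.
  have [->|_] := eqVneq u k; first by rewrite mulr1 xk.
  by rewrite tE mulrC.
have [xE t'k] := t'E.
have [e eE] : exists e : 'rV[S]_m, forall j, Y k j = al * e 0 j.
  have /choice[t tE] j : exists z, Y k j = z * al.
    by rewrite mxE X1E; apply: (kiP (k, _)).
  by exists (\row_j t j) => j; rewrite tE mxE mulrC.
clearbody x Y.
(* Column operations with the pivot clear row [k] outside the first column; the other rows are kept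
   and passed to the induction hypothesis. *)
pose Y' := Y - x *m e.
have Y'k : row k Y' = 0.
  by apply/rowP => j; rewrite !mxE big_ord1 xk eE subrr.
have [Q [Q' [a [QQ' Q'Q QP]]]] := IH Y'.
pose P0 : 'M[S]_(1 + m) := block_mx 1%:M (- e) 0 1%:M.
pose P0' : 'M[S]_(1 + m) := block_mx 1%:M e 0 1%:M.
pose Q0 : 'M[S]_(1 + m) := block_mx 1%:M 0 0 Q.
pose Q0' : 'M[S]_(1 + m) := block_mx 1%:M 0 0 Q'.
have P00' : P0 *m P0' = 1%:M.
  rewrite mulmx_block !mulmx1 !mul1mx !mulmx0 !mul0mx !addr0 !add0r subrr.
  by rewrite -scalar_mx_block.
have P0'0 : P0' *m P0 = 1%:M.
  rewrite mulmx_block !mulmx1 !mul1mx !mulmx0 !mul0mx !addr0 !add0r addrC subrr.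
  by rewrite -scalar_mx_block.
have Q00' : Q0 *m Q0' = 1%:M.
  rewrite mulmx_block !mulmx1 !mulmx0 !mul0mx !addr0 !add0r QQ'.
  by rewrite -scalar_mx_block.
have Q0'0 : Q0' *m Q0 = 1%:M.
  rewrite mulmx_block !mulmx1 !mulmx0 !mul0mx !addr0 !add0r Q'Q.
  by rewrite -scalar_mx_block.
pose P := T *m P0 *m Q0; pose P' := Q0' *m (P0' *m T).
have inv n (B B' C C' : 'M[S]_n) : B *m B' = 1%:M -> C *m C' = 1%:M ->
    (B *m C) *m (C' *m B') = 1%:M.
  by move=> BB' CC'; rewrite mulmxA -(mulmxA B) CC' mulmx1.
have PP' : P *m P' = 1%:M by exact: (inv _ _ _ _ _ (inv _ _ _ _ _ TT P00') Q00').
have P'P : P' *m P = 1%:M by exact: (inv _ _ _ _ _ Q0'0 (inv _ _ _ _ _ P0'0 TT)).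
have XP : X *m P = row_mx x (Y' *m Q).
  rewrite /P !mulmxA XE mul_row_block !mulmx1 mulmx0 addr0 mulmxN addrC.
  by rewrite mul_row_block !mulmx1 !mulmx0 addr0 add0r.
exists P, P', (row_mx al%:M a); split=> // c.
have diagE (u : 'M[S]_1) (d : 'rV[S]_m) :
    row_mx u d *m diag_mx (row_mx al%:M a) = row_mx (al *: u) (d *m diag_mx a).
  by rewrite diag_mx_row mul_row_block !mulmx0 addr0 add0r
     (_ : diag_mx al%:M = al%:M) ?mul_mx_scalar //; apply/matrixP => p q; rewrite !mxE !ord1.
split=> [[y yE]|[f fE]].
  have [d dE] := (QP (y *m Y')).1 (ex_intro _ y erefl).
  exists (row_mx (y *m t') d).
  rewrite yE -mulmxA XP mul_mx_row mulmxA dE [RHS]diagE xE.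
  by rewrite -scalemxAr.
pose f1 : 'M[S]_1 := lsubmx (f : 'rV[S]_(1 + m)).
pose f2 : 'rV[S]_m := rsubmx (f : 'rV[S]_(1 + m)).
have fE' : f = row_mx f1 f2 by rewrite hsubmxK.
have [|y' y'E] := (QP (f2 *m diag_mx a *m Q')).2.
  by exists f2; rewrite -!mulmxA Q'Q mulmx1.
(* Adding [z] times the pivot row corrects the first coordinate and leaves the others alone, since
   row [k] of [Y'] is zero. *)
pose z : 'M[S]_1 := f1 - y' *m t'.
exists (y' + z *m delta_mx 0 k).
have Pinj (u u' : 'rV[S]_(1 + m)) : u *m P = u' *m P -> u = u'.
  by move=> /(congr1 (mulmx^~ P')); rewrite -!(mulmxA _ P) PP' !mulmx1.
apply: Pinj; rewrite fE fE' diagE -(mulmxA _ X P) XP mul_mx_row; congr row_mx.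
  rewrite xE -scalemxAr mulmxDl -mulmxA -rowE.
  have -> : row k t' = 1%:M by apply/matrixP => p q; rewrite !mxE !ord1 t'k.
  by rewrite mulmx1 /z (addrC (y' *m t')) subrK.
rewrite mulmxA mulmxDl -mulmxA -rowE Y'k mulmx0 addr0 -y'E -mulmxA Q'Q.
by rewrite mulmx1.
Qed.

Lemma smith m s (X : 'M[S]_(s, m)) : smith_form X.
Proof.
elim: m s X => [|m IH] s X.
  exists 1%:M, 1%:M, 0; split; rewrite ?mulmx1 // => c.
  by split=> _; exists 0; rewrite !thinmx0 ?mul0mx.
case: s X => [|s] X; last exact: smith_step.
exists 1%:M, 1%:M, 0; split; rewrite ?mulmx1 // => c; rewrite mulmx1.
split=> -[y ->]; exists 0; rewrite mul0mx ?linear0 ?mulmx0 //.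
by rewrite (flatmx0 X) mulmx0.
Qed.

End Smith.

(** * Freeness of images over a base with total divisibility *)

Section Freeness.
Variable S : comNzRingType.
Hypothesis div_total : forall x y : S, (exists z, y = z * x) \/ (exists z, x = z * y).
Hypothesis dom : forall x y : S, x * y = 0 -> x = 0 \/ y = 0.

Lemma free_of_rank_gens (M : lmodType S) n (b : 'I_n -> M) :
  (forall x, exists c : 'I_n -> S, x = \sum_i c i *: b i) ->
  (forall c : 'I_n -> S, \sum_i c i *: b i = 0 -> forall i, c i = 0) ->
  free_of_rank M n.
Proof.
move=> /choice[co coE] bfree; apply/free_of_rankP; exists b, co; split=> // c i.
apply/eqP; rewrite -subr_eq0; apply/eqP.
apply: (bfree (fun i => co (\sum_j c j *: b j) i - c i)).
under eq_bigr do rewrite scalerBl.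
by rewrite sumrB -coE subrr.
Qed.

(** [Q] is isomorphic to the image of [psi]. In a Smith form of the matrix of [psi], that image is
    spanned by multiples of basis vectors, and the nonzero elementary divisors, at most [n] of them,
    index a basis. *)
Lemma image_free (A A' Q : comAlgType S) (psi : {lrmorphism A -> A'})
    (pi : {lrmorphism A -> Q}) s n :
  free_of_rank A s -> free_of_rank A' n ->
  (forall q, exists x, pi x = q) -> (forall x, pi x = 0 <-> psi x = 0) ->
  exists2 m, (m <= n)%N & free_of_rank Q m.
Proof.
move=> /free_of_rankP[e [ce ece]] /free_of_rankP[b [co bco]] piS piK.
have [P [P' [a [PP' P'P XP]]]] := smith div_total (\matrix_(k, j) co (psi (e k)) j).
pose crd x : 'rV[S]_n := \row_j co (psi x) j.
have crdE x : crd x = (\row_k ce x k) *m \matrix_(k, j) co (psi (e k)) j.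
  apply/rowP => j; rewrite !mxE {1}(basisE ece x) lrm_sum (coord_sum bco).
  by apply: eq_bigr => k _; rewrite lrmZ (coordZ bco) !mxE.
have crd_surj y : exists x, crd x = y *m \matrix_(k, j) co (psi (e k)) j.
  exists (\sum_k y 0 k *: e k); rewrite crdE; congr (_ *m _).
  by apply/rowP => k; rewrite mxE (coordE ece).
have crd_inj x y : crd x = crd y -> pi x = pi y.
  move=> xy; apply/eqP; rewrite -subr_eq0 -lrmB; apply/eqP/piK.
  rewrite lrmB; apply/eqP; rewrite subr_eq0; apply/eqP/(coord_inj bco) => j.
  by have /rowP/(_ j) := xy; rewrite !mxE.
pose I := [set i | a 0 i != 0].
pose a' (k : 'I_#|I|) : S := a 0 (enum_val k).
have a'0 k : a' k <> 0 by apply/eqP; have := enum_valP k; rewrite inE.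
(* [psi (f k)] is [a' k] times a vector of the new basis; the classes of the [f k] will be the basis
   of [Q]. *)
have /choice[f fE] (k : 'I_#|I|) : exists x, crd x *m P = a' k *: delta_mx 0 (enum_val k).
  have [|y yE] := (XP (a' k *: delta_mx 0 (enum_val k) *m P')).2.
    exists (delta_mx 0 (enum_val k)); rewrite -mulmxA P'P mulmx1.
    apply/rowP => j; rewrite mul_mx_diag !mxE eqxx /=.
    by case: (eqVneq j) => [->|_]; rewrite ?mulr1 ?mul1r ?mulr0 ?mul0r.
  by have [x xE] := crd_surj y; exists x; rewrite xE -yE -mulmxA P'P mulmx1.
have crdD x y : crd (x + y) = crd x + crd y.
  by apply/rowP => j; rewrite !mxE lrmD (coordD bco).
have crdZ t x : crd (t *: x) = t *: crd x.
  by apply/rowP => j; rewrite !mxE lrmZ (coordZ bco).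
have crd_sum (c : 'I_#|I| -> S) :
    crd (\sum_k c k *: f k) *m P = \sum_k (c k * a' k) *: delta_mx 0 (enum_val k).
  elim/big_rec2: _ => [|k x y _ <-].
    by rewrite -(scale0r 0) crdZ scale0r mul0mx.
  by rewrite crdD mulmxDl crdZ -scalemxAl fE scalerA.
have Pinj (u w : 'rV[S]_n) : u *m P = w *m P -> u = w.
  by move=> /(congr1 (mulmx^~ P')); rewrite -!(mulmxA _ P) PP' !mulmx1.
exists #|I|; first by rewrite -[n in (_ <= n)%N]card_ord max_card.
apply: (@free_of_rank_gens _ _ (fun k => pi (f k))).
  move=> q; have [x <-] := piS q.
  have [d dE] := (XP (crd x)).1 (ex_intro _ _ (crdE x)).
  exists (fun k => d 0 (enum_val k)).
  have -> : \sum_k d 0 (enum_val k) *: pi (f k) = pi (\sum_k d 0 (enum_val k) *: f k).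
    by rewrite lrm_sum; apply: eq_bigr => k _; rewrite lrmZ.
  apply/crd_inj/Pinj; rewrite dE crd_sum.
  apply/rowP => j; rewrite mul_mx_diag mxE summxE.
  have [jI|jI] := boolP (j \in I).
    rewrite (bigD1 (enum_rank_in jI j)) //= !mxE enum_rankK_in // !eqxx /= mulr1.
    rewrite /a' enum_rankK_in // big1 ?addr0 // => k kj.
    rewrite !mxE eqxx /=; case: (eqVneq j) => [jk|]; rewrite ?mulr0 //.
    by case/eqP: kj; apply: enum_val_inj; rewrite enum_rankK_in.
  rewrite big1; first by move: jI; rewrite inE negbK => /eqP->; rewrite mulr0.
  move=> k _; rewrite !mxE eqxx /=; case: (eqVneq j) => [jk|]; rewrite ?mulr0 //.
  by case/negP: jI; rewrite jk enum_valP.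
move=> c c0 k.
have : crd (\sum_k c k *: f k) *m P = 0.
  rewrite -(mul0mx _ P); congr (_ *m _); apply/rowP => j; rewrite !mxE.
  have /piK -> : pi (\sum_k c k *: f k) = 0.
    by rewrite lrm_sum -[RHS]c0; apply: eq_bigr => l _; rewrite lrmZ.
  exact: (coord0 bco).
rewrite crd_sum => /rowP/(_ (enum_val k)); rewrite summxE mxE.
rewrite (bigD1 k) //= big1 => [|l lk].
  by rewrite !mxE !eqxx mulr1 addr0 => /dom[//|/a'0].
rewrite !mxE eqxx /=; case: eqVneq => [kl|]; rewrite ?mulr0 //.
by case/eqP: lk; apply: enum_val_inj.
Qed.

End Freeness.

(** * Diagonal presentations of the cotangent space *)

Section OmegaExistence.
Variable S : comNzRingType.
Hypothesis div_total : forall x y : S, (exists z, y = z * x) \/ (exists z, x = z * y).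

(** omega is finitely presented, generated by the centred basis vectors [g k]; a Smith form of the
    relation matrix gives the cyclic summands. *)
Lemma omega_iso_exists (G : gscheme S) : finite_flat G ->
  exists r (a : 'I_r -> S), omega_iso G a.
Proof.
move=> [n /free_of_rankP[b [co bco]]].
pose g k := b k - (eps G (b k))%:A.
have g0 k : eps G (g k) = 0 by apply: eps_sub.
have gE (c : 'I_n -> S) : \sum_k c k *: g k =
    \sum_k c k *: b k - (\sum_k c k * eps G (b k))%:A.
  under eq_bigr do rewrite scalerBr scalerA.
  by rewrite sumrB -scaler_suml.
have coE z : \sum_k co z k *: g k = z - (eps G z)%:A by apply: aug_basis.
have coI z : eps G z = 0 -> z = \sum_k co z k *: g k.
  by move=> z0; rewrite coE z0 scale0r subr0.
pose I := ('I_n * 'I_n)%type.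
pose s := #|{: I}|; pose ev (u : 'I_s) : I := enum_val u.
pose gg (u : I) := g u.1 * g u.2.
pose X2 := \matrix_(u < s, j < n) co (gg (ev u)) j.
(* The top row is the linear relation between the [g k]: the coordinates of 1 combine them to 1 - 1
   = 0. The other rows express the products of two of the [g k], which span the squared augmentation
   ideal. *)
pose X := col_mx (\row_j co 1 j) X2.
have gg0 u : eps G (gg u) = 0 by rewrite lrmM g0 mul0r.
have X2E (y : 'rV[S]_s) : \sum_j (y *m X2) 0 j *: g j =
    \sum_u y 0 u *: gg (ev u).
  under eq_bigr do rewrite mxE scaler_suml.
  rewrite exchange_big; apply: eq_bigr => u _ /=.
  rewrite [in RHS](coI _ (gg0 _)) scaler_sumr; apply: eq_bigr => j _.
  by rewrite mxE scalerA.
have relP (c : 'rV[S]_n) : aug_ideal_sq (\sum_j c 0 j *: g j) <-> exists y, c = y *m X.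
  split; last first.
    move=> [y ->]; rewrite -[y]hsubmxK mul_row_col.
    rewrite (_ : \sum_j _ = \sum_j (lsubmx y *m \row_j co 1 j) 0 j *: g j +
        \sum_j (rsubmx y *m X2) 0 j *: g j); last first.
      by rewrite -big_split; apply: eq_bigr => j _; rewrite mxE scalerDl.
    rewrite X2E; apply: aug_sqD; last first.
      by apply: aug_sq_sum => u _; apply: aug_sqZ; apply: aug_sqM.
    under eq_bigr do rewrite mxE big_ord1 [(\row_j co 1 j) _ _]mxE -scalerA.
    rewrite -scaler_sumr coE lrm1 scale1r subrr scaler0; exact: aug_sq0.
  move=> [m [y [z [yz cE]]]].
  pose d : 'rV[S]_s :=
    \row_u \sum_k co (y k) (ev u).1 * co (z k) (ev u).2.
  have dE : \sum_j (d *m X2) 0 j *: g j = \sum_j c 0 j *: g j.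
    rewrite X2E cE.
    under eq_bigr do rewrite mxE scaler_suml.
    rewrite exchange_big; apply: eq_bigr => k _ /=.
    have [yk zk] := yz k.
    rewrite [in RHS](coI _ yk) [in RHS](coI _ zk).
    rewrite mulr_suml.
    under [in RHS]eq_bigr do rewrite mulr_sumr.
    rewrite pair_big /= [in RHS](reindex_onto ev enum_rank) /=.
      by apply: eq_big => [u|u _]; rewrite ?enum_valK ?eqxx // -scalerAl -scalerAr scalerA.
    by move=> u _; apply: enum_rankK.
  pose c' := c - d *m X2.
  (* Since [c'] combines the [g j] to zero, it combines the [b j] to the constant [la], so it is
     [la] times the coordinates of 1. *)
  pose la := \sum_j c' 0 j * eps G (b j).
  have c'E : c' = la *: \row_j co 1 j.
    apply/rowP => j; rewrite [RHS]mxE [in RHS]mxE -(coordZ bco).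
    rewrite -(coordE bco (c' 0) j); congr (co _ j).
    apply/eqP; rewrite -subr_eq0 -gE; apply/eqP.
    under eq_bigr do rewrite mxE mxE scalerDl scaleNr.
    by rewrite big_split sumrN /= dE subrr.
  exists (row_mx la%:M d); rewrite mul_row_col mul_scalar_mx -c'E.
  by rewrite subrK.
have [P [P' [a [PP' P'P XP]]]] := smith div_total X.
pose w i := \sum_l P' i l *: g l.
have wE (c : 'rV[S]_n) : \sum_i c 0 i *: w i = \sum_l (c *m P') 0 l *: g l.
  under eq_bigr do rewrite scaler_sumr.
  rewrite exchange_big; apply: eq_bigr => l _ /=.
  by rewrite mxE scaler_suml; apply: eq_bigr => i _; rewrite scalerA.
exists n, (fun i => a 0 i), w; split=> [i|x /coI xE|c].
- rewrite aug_idealE lrm_sum big1 // => l _.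
  by rewrite lrmZ g0 scaler0.
- exists (((\row_l co x l) *m P) 0); rewrite wE -mulmxA PP' mulmx1.
  under eq_bigr do rewrite mxE.
  by rewrite -xE subrr; apply: aug_sq0.
have -> : \sum_i c i *: w i = \sum_i (\row_l c l) 0 i *: w i.
  by apply: eq_bigr => i _; rewrite mxE.
rewrite wE; split.
  move=> /relP/XP[e]; rewrite -mulmxA P'P mulmx1 => /rowP eE i.
  by exists (e 0 i); have := eE i; rewrite mul_mx_diag !mxE mulrC.
move=> /choice[e eE]; apply/relP/XP; exists (\row_i e i).
rewrite -mulmxA P'P mulmx1; apply/rowP => i.
by rewrite mul_mx_diag !mxE mulrC.
Qed.

End OmegaExistence.

(** * Degrees over a valuation ring *)

Section ValuationRing.
Variables (R : realType) (K : fieldType) (v : valuation K R).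
Local Notation OK := (val_ring v).

Lemma val_ring_ge0 (x : OK) : (0 <= v (val x))%E.
Proof. exact: (valP x). Qed.

Lemma vfun_fin (x : K) : x != 0 -> v x \is a fin_num.
Proof.
move=> x0; rewrite fin_numE; apply/andP; split; first exact/eqP/vfun_neqNy.
by apply: contra_neq x0 => /vfun_eqy.
Qed.

Lemma vfunV (x : K) : x != 0 -> v x^-1 = (- v x)%E.
Proof.
move=> x0; have := vfunM v x x^-1; rewrite mulfV // vfun1.
rewrite -(fineK (vfun_fin x0)) -(fineK (vfun_fin (invr_neq0 x0))).
rewrite -EFinD => -[] /eqP; rewrite eq_sym addrC addr_eq0 => /eqP ->.
by rewrite EFinN.
Qed.

Lemma val_ring_div (x y : OK) : val x != 0 -> (v (val x) <= v (val y))%E ->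
  exists z, y = z * x.
Proof.
move=> x0 xy.
have z0 : val y / val x \in val_integral v.
  rewrite unfold_in vfunM vfunV // sube_ge0 ?xy //.
  by rewrite (vfun_fin x0).
by exists (ValRing z0); apply: val_inj; rewrite /= divfK.
Qed.

Lemma val_ring_total (x y : OK) : (exists z, y = z * x) \/ (exists z, x = z * y).
Proof.
have [x0|x0] := eqVneq (val x) 0.
  by right; exists 0; rewrite mul0r; apply: val_inj.
have [y0|y0] := eqVneq (val y) 0.
  by left; exists 0; rewrite mul0r; apply: val_inj.
by have [xy|/ltW yx] := leP (v (val x)) (v (val y)); [left | right];
  apply: val_ring_div.
Qed.

Lemma val_ring_domain (x y : OK) : x * y = 0 -> x = 0 \/ y = 0.
Proof.
move=> /(congr1 val) /= /eqP; rewrite mulf_eq0 => /orP[] /eqP e; [left | right];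
  exact: val_inj.
Qed.

Lemma vfun_prod I (r : seq I) (F : I -> OK) :
  v (val (\prod_(i <- r) F i)) = (\sum_(i <- r) v (val (F i)))%E.
Proof.
elim/big_rec2: _ => [|i x y _ <-]; first by rewrite /= vfun1.
by rewrite /= vfunM.
Qed.

Section Degree.
Variable p : nat.
Hypothesis vp : v p%:R = 1%E.

Lemma vfun_pX n : v (val (p%:R ^+ n : OK)) = n%:R%:E.
Proof.
elim: n => [|n IH]; first by rewrite expr0 /= vfun1.
rewrite exprS [val _]/= vfunM [v (val (_ ^+ _))]IH.
have -> : val (p%:R : OK) = p%:R by rewrite rmorph_nat.
by rewrite vp -EFinD mulrS.
Qed.

Lemma vfun_pn n : v (val ((p ^ n)%:R : OK)) = n%:R%:E.
Proof. by rewrite natrX vfun_pX. Qed.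

Lemma pn_neq0 n : (p ^ n)%:R != 0 :> OK.
Proof.
apply/eqP => pn0; have := vfun_pn n; rewrite pn0 /=.
by have /vfun_eqy -> : (0 : K) = 0 by [].
Qed.

(** [deg] is chosen by [xget] with default 0, so the set it chooses from must be shown nonempty.
    Each [a i] divides [p ^ n] because [p ^ n] kills omega; hence it is nonzero and the sum of
    valuations is finite. *)
Lemma degP (G : gscheme OK) n : finite_flat G -> killed_by (p ^ n) G ->
  exists r (a : 'I_r -> OK), omega_iso G a /\ (deg G)%:E = (\sum_i v (val (a i)))%E.
Proof.
move=> Gff Gn; apply: (@xgetPex _ 0 [set d : R | exists r (a : 'I_r -> OK),
  omega_iso G a /\ d%:E = (\sum_i v (val (a i)))%E]%classic).
have [r [a oa]] := omega_iso_exists val_ring_total Gff.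
have a0 i : val (a i) != 0.
  have [w [w0 _ wP]] := oa.
  have : aug_ideal_sq (\sum_j (if j == i then (p ^ n)%:R else 0) *: w j).
    rewrite (bigD1 i) //= eqxx big1 => [|j /negbTE ->]; last by rewrite scale0r.
    by rewrite addr0 scaler_nat; apply: killed_aug (w0 i).
  move=> /wP/(_ i)[b]; rewrite eqxx => pE.
  apply/eqP => ai0; have /eqP[] := pn_neq0 n.
  by rewrite pE (_ : a i = 0) ?mul0r //; apply: val_inj.
exists (\sum_i fine (v (val (a i)))), r, a; split=> //.
rewrite -sumEFin; apply: eq_bigr => i _.
by rewrite fineK // vfun_fin.
Qed.

Lemma deg_ge0 (G : gscheme OK) : 0 <= deg G.
Proof.
rewrite /deg; case: xgetP => // d _ [r [a [_ dE]]].
by rewrite -lee_fin dE; apply: sume_ge0 => i _; apply: val_ring_ge0.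
Qed.

(* The al (y i), for y a diagonal presentation of omega_G'', and the u k generate
   omega_G', with a square matrix of relations whose determinant has valuation
   deg G'' + N d. *)
Lemma deg_le (G' G'' : gscheme OK) (al : {lrmorphism G'' -> G'}) d (u : 'I_d -> G') N n :
  finite_flat G' -> killed_by (p ^ n) G' ->
  finite_flat G'' -> killed_by (p ^ n) G'' ->
  (forall t, eps G'' t = 0 -> eps G' (al t) = 0) ->
  (forall x, eps G' x = 0 -> exists (c : 'I_d -> OK) t, eps G'' t = 0 /\
     aug_ideal_sq (x - \sum_k c k *: u k - al t)) ->
  (forall k, eps G' (u k) = 0) ->
  (forall k, exists2 t, eps G'' t = 0 & aug_ideal_sq (u k *+ p ^ N - al t)) ->
  deg G' <= deg G'' + (N * d)%:R.
Proof.
move=> ff' k' ff'' k'' alI gen u0 tor.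
have [s [a [[w [w0 wg wP]] aE]]] := degP ff' k'.
have [r [b [[y [y0 yg yP]] bE]]] := degP ff'' k''.
have al_span t : eps G'' t = 0 -> exists c : 'I_r -> OK,
    aug_ideal_sq (al t - \sum_i c i *: al (y i)).
  move=> /yg[c cE]; exists c.
  rewrite (_ : _ - _ = al (t - \sum_i c i *: y i)); first exact: aug_sq_hom.
  by rewrite lrmB lrm_sum; under [in RHS]eq_bigr do rewrite lrmZ.
have [C CE] : exists C : 'I_d -> 'I_r -> OK, forall k,
    aug_ideal_sq (u k *+ p ^ N - \sum_i C k i *: al (y i)).
  have Ck k : exists C : 'I_r -> OK, aug_ideal_sq (u k *+ p ^ N - \sum_i C i *: al (y i)).
    have [t t0 tE] := tor k; have [c cE] := al_span t t0.
    by exists c; apply: aug_sq_trans tE cE.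
  by have [C CP] := choice Ck; exists C.
pose g (i : 'I_(r + d)) := match fintype.split i with inl i => al (y i) | inr k => u k end.
have gl i : g (lshift d i) = al (y i) by rewrite /g (unsplitK (inl _ i)).
have gr k : g (rshift r k) = u k by rewrite /g (unsplitK (inr _ k)).
pose X : 'M[OK]_(r + d) := block_mx (diag_mx (\row_i b i)) 0
  (- \matrix_(k, i) C k i) (p ^ N)%:R%:M.
have g0 x : eps G' x = 0 -> exists c : 'I_(r + d) -> OK,
    aug_ideal_sq (x - \sum_i c i *: g i).
  move=> /gen[c [t [t0 ct]]]; have [e eE] := al_span t t0.
  exists (fun i => match fintype.split i with inl i => e i | inr k => c k end).
  rewrite big_split_ord /=.
  under eq_bigr do rewrite (unsplitK (inl _ _)) gl.
  under [X in _ - (_ + X)]eq_bigr do rewrite (unsplitK (inr _ _)) gr.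
  rewrite [X in _ - X]addrC opprD addrA.
  move: ct eE; set X1 := x - _ => ct eE.
  have -> : X1 - \sum_i e i *: al (y i) = (X1 - al t) + (al t - \sum_i e i *: al (y i)).
    by rewrite subrKA.
  exact: aug_sqD.
have gI i : eps G' (g i) = 0.
  by rewrite /g; case: fintype.split => k //; apply/alI/y0.
have /choice[P PE] i := wg (g i) (gI i).
have /choice[Q QE] j := g0 (w j) (w0 j).
have by0 i : aug_ideal_sq (b i *: al (y i)).
  rewrite -lrmZ; apply: (aug_sq_hom alI).
  have /yP : forall j, exists z, (if j == i then b i else 0) = b j * z.
    by move=> j; case: eqP => [->|_]; [exists 1; rewrite mulr1 | exists 0; rewrite mulr0].
  rewrite (bigD1 i) //= eqxx big1 ?addr0 // => j /negbTE->.
  by rewrite scale0r.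
have Xul i j : X (lshift d i) (lshift d j) = b i *+ (i == j).
  by rewrite block_mxEul !mxE.
have Xur i j : X (lshift d i) (rshift r j) = 0 by rewrite block_mxEur mxE.
have Xdl k j : X (rshift r k) (lshift d j) = - C k j by rewrite block_mxEdl !mxE.
have Xdr k j : X (rshift r k) (rshift r j) = (p ^ N)%:R *+ (k == j).
  by rewrite block_mxEdr mxE.
have Xg i : aug_ideal_sq (\sum_j X i j *: g j).
  rewrite big_split_ord /=.
  under eq_bigr do rewrite gl; under [X in _ + X]eq_bigr do rewrite gr.
  rewrite -[i]splitK; case: (fintype.split i) => k /=.
    rewrite (bigD1 k) //= Xul eqxx mulr1n.
    rewrite big1 => [|j jk]; last by rewrite Xul eq_sym (negbTE jk) scale0r.
    rewrite big1 => [|j _]; last by rewrite Xur scale0r.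
    by rewrite !addr0; apply: by0.
  under eq_bigr do rewrite Xdl scaleNr.
  rewrite (bigD1 k) //= Xdr eqxx mulr1n [X in _ + (_ + X)]big1 => [|j jk]; last first.
    by rewrite Xdr eq_sym (negbTE jk) scale0r.
  by rewrite addr0 scaler_nat sumrN addrC; apply: CE.
have [] := @fitting_det OK G' (@aug_ideal_sq _ G') (aug_sq0 _) (@aug_sqD _ _)
  (@aug_sqZ _ _) s (r + d) w a g (\matrix_(i, j) P i j) (\matrix_(j, i) Q j i) X.
- by move=> c /wP.
- by move=> i; under eq_bigr do rewrite mxE.
- by move=> j; under eq_bigr do rewrite mxE.
- exact: Xg.
move=> z; rewrite det_lblock det_diag det_scalar -natrX -expnM.
move=> /(congr1 (fun x => v (val x))); rewrite /= !vfunM !vfun_prod -aE vfun_pn.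
under eq_bigr do rewrite mxE.
rewrite -bE -EFinD => e; rewrite -lee_fin e -[X in (X <= _)%E]add0e.
by rewrite leeD2r // val_ring_ge0.
Qed.

End Degree.
End ValuationRing.

(** * Harder-Narasimhan polygons *)

Section ConcaveEnvelope.
Variable R : realType.
Implicit Types (P : set (R * R)) (b C : R).

Lemma convex_oppE (f : R -> R) b :
  @convex_function R R^o `[0, b]%classic (fun t => - f t) <->
  forall t x y, 0 <= t <= 1 -> 0 <= x <= b -> 0 <= y <= b ->
    t * f x + (1 - t) * f y <= f (t * x + (1 - t) * y).
Proof.
split=> [fcv t x y /andP[t0 t1] xb yb|fcv t x y xD yD].
  have : - f (t * x + (1 - t) * y) <= t * - f x + (1 - t) * - f y.
    by apply: (fcv (Itv01 t0 t1) x y); rewrite in_setE /= in_itv.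
  by rewrite !mulrN -opprD lerN2.
have : t%:num * f x + (1 - t%:num) * f y <= f (t%:num * x + (1 - t%:num) * y).
  apply: fcv; first by apply/andP; split.
    by move: xD; rewrite in_setE /= in_itv.
  by move: yD; rewrite in_setE /= in_itv.
move=> H; have : - f (t%:num * x + (1 - t%:num) * y) <=
    t%:num * - f x + (1 - t%:num) * - f y by rewrite !mulrN -opprD lerN2.
by [].
Qed.

Lemma concave_ge (f : R -> R) b c x y z :
  @convex_function R R^o `[0, b]%classic (fun t => - f t) ->
  0 <= x -> x <= z -> z <= y -> y <= b -> c <= f x -> c <= f y -> c <= f z.
Proof.
move=> /convex_oppE fcv x0 xz zy yb cx cy.
have [xy|xy] := eqVneq x y.
  by have -> : z = x by apply/le_anti; rewrite xz xy zy.
have yx0 : 0 < y - x by rewrite subr_gt0 lt_def eq_sym xy (le_trans xz zy).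
pose t := (y - z) / (y - x).
have t0 : 0 <= t by rewrite divr_ge0 ?(ltW yx0) ?subr_ge0.
have t1 : t <= 1 by rewrite ler_pdivrMr // mul1r lerB.
have := fcv t x y; rewrite t0 t1 x0 yb.
rewrite (le_trans (le_trans xz zy) yb) (le_trans x0 (le_trans xz zy)).
move=> /(_ isT isT isT).
have -> : t * x + (1 - t) * y = z.
  have -> : t * x + (1 - t) * y = y - t * (y - x) by ring.
  by rewrite /t divfK ?gt_eqF // subKr.
apply: le_trans.
have -> : c = t * c + (1 - t) * c by ring.
by apply: lerD; apply: ler_wpM2l; rewrite ?subr_ge0.
Qed.

(** For the points of a group, the trivial subgroup gives the point above 0 and the whole group the
    highest point, which lies above [b]. *)
Definition spans_strip b P :=
  [/\ forall t, P t -> [/\ 0 <= t.1, t.1 <= b & 0 <= t.2],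
      exists y, P (0, y) &
      exists D, P (b, D) /\ forall t, P t -> t.2 <= D].

(* No lower bound on s.1 is needed: to the right of s.1, a concave function above
   P2 stays above s.2, as it does so at b. *)
Lemma envelope_le b C P1 P2 x :
  spans_strip b P1 -> spans_strip b P2 -> 0 <= x -> x <= b ->
  (forall t, P1 t -> exists2 s, P2 s & s.1 <= t.1 /\ t.2 <= s.2 + C) ->
  upper_concave_envelope b P1 x <= upper_concave_envelope b P2 x + C.
Proof.
move=> [P1b [y0 P1y0] [D1 [P1D1 _]]] [P2b _ [D2 [P2D2 P2le]]] x0 xb P12.
rewrite -lerBlDr; apply: lb_le_inf.
  exists D2, (fun=> D2) => //; split=> //; apply/convex_oppE => t u w _ _ _.
  by rewrite -mulrDl addrC subrK mul1r.
move=> _ [f [fcv fP2] <-]; rewrite lerBlDr; apply: ge_inf.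
  exists 0 => _ [g [gcv gP1] <-].
  have [_ _ y0_ge0] := P1b _ P1y0; have [_ _ D1_ge0] := P1b _ P1D1.
  apply: (concave_ge gcv (lexx 0) x0 xb (lexx b)).
    exact: le_trans y0_ge0 (gP1 _ P1y0).
  exact: le_trans D1_ge0 (gP1 _ P1D1).
exists (fun t => f t + C) => //; split.
  apply/convex_oppE => t u w t01 ub wb; have := (convex_oppE f b).1 fcv t u w t01 ub wb.
  have -> : t * (f u + C) + (1 - t) * (f w + C) = t * f u + (1 - t) * f w + C by ring.
  by rewrite lerD2r.
move=> t P1t; have [s P2s [st tsC]] := P12 _ P1t.
apply: le_trans tsC _; rewrite lerD2r.
have [s0 sb _] := P2b _ P2s; have [_ tb _] := P1b _ P1t.
apply: (concave_ge fcv s0 st tb (lexx b)); first exact: fP2.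
exact: le_trans (P2le _ P2s) (fP2 _ P2D2).
Qed.

End ConcaveEnvelope.

(** * Ranks of free modules *)

Section Rank.
Variable S : comNzRingType.

(** If m < r, padding [U] with zero columns and [V] with zero rows makes them square without
    changing the product; the padded [U] has determinant 0, so D^r would be 0. *)
Lemma mul_scalar_rank r m (U : 'M[S]_(r, m)) (V : 'M[S]_(m, r)) D :
  U *m V = D%:M -> (forall k, D ^+ k != 0) -> (r <= m)%N.
Proof.
move=> UV D0; rewrite leqNgt; apply/negP => mr.
have [k rE] : exists k, r = (m + k.+1)%N by exists (r - m).-1; lia.
subst r.
have UE : row_mx U (0 : 'M[S]_(m + k.+1, k.+1)) =
    block_mx (usubmx U) 0 (dsubmx U) 0.
  by rewrite block_mxEh vsubmxK col_mx0.
have : \det (row_mx U (0 : 'M[S]_(m + k.+1, k.+1)) *m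
              col_mx V (0 : 'M[S]_(k.+1, m + k.+1))) = D ^+ (m + k.+1).
  by rewrite mul_row_col mul0mx addr0 UV det_scalar.
rewrite det_mulmx UE det_lblock det0 // mulr0 mul0r => /esym/eqP.
by rewrite (negbTE (D0 _)).
Qed.

Lemma free_rank_le (M : lmodType S) m n : free_of_rank M m -> free_of_rank M n -> (m <= n)%N.
Proof.
move=> /free_of_rankP[b [co bco]] /free_of_rankP[b' [co' bco']].
apply: (@mul_scalar_rank m n (\matrix_(i, j) co' (b i) j) (\matrix_(j, i) co (b' j) i) 1).
  apply/matrixP => i k; rewrite !mxE; under eq_bigr do rewrite !mxE.
  rewrite eq_sym -(coord_basis bco) [in RHS](basisE bco' (b i)) (coord_sum bco).
  by apply: eq_bigr => j _; rewrite (coordZ bco).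
by move=> k; rewrite expr1n oner_neq0.
Qed.

Lemma free_rank_uniq (M : lmodType S) m n : free_of_rank M m -> free_of_rank M n -> m = n.
Proof. by move=> Mm Mn; apply/eqP; rewrite eqn_leq (free_rank_le Mm) ?(free_rank_le Mn). Qed.

Lemma orderE (G : gscheme S) n : free_of_rank G n -> Defs.order G = n.
Proof.
move=> Gn; rewrite /Defs.order; apply: free_rank_uniq (Gn).
by apply: (@xgetPex _ 0%N [set k | free_of_rank G k]%classic); exists n; apply: Gn.
Qed.

Lemma rank_gt0 (A : comAlgType S) n : free_of_rank A n -> (0 < n)%N.
Proof.
move=> /free_of_rankP[b [co bco]]; rewrite lt0n; apply/eqP => n0.
have /eqP[] := oner_neq0 A; rewrite (basisE bco 1) big1 // => i _.
by exfalso; have := ltn_ord i; rewrite {2}n0.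
Qed.

End Rank.

(** * Closed subgroups and their images under a map with bounded kernel *)

Section Subgroups.
Variables (R : realType) (K : fieldType) (v : valuation K R) (p : nat).
Hypothesis vp : v p%:R = 1%E.
Hypothesis p_pr : prime p.
Local Notation OK := (val_ring v).

Lemma hmap_closed_inj (G1 G2 : gscheme OK) (f : ghom G1 G2) B :
  closed_immersion f -> injective (@hmap _ _ _ f B).
Proof. by move=> fS x y; apply: lrcomp_surj_inj. Qed.

Lemma closed_killed (G1 G2 : gscheme OK) (f : ghom G1 G2) n :
  closed_immersion f -> killed_by n G2 -> killed_by n G1.
Proof.
move=> fS G2n B x; apply: (hmap_closed_inj fS).
by rewrite raddfMn /= G2n raddf0.
Qed.

Lemma htE (G : gscheme OK) n : free_of_rank G n -> ht p G = ln n%:R / ln p%:R.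
Proof. by move=> Gn; rewrite /ht (orderE Gn). Qed.

Lemma lnp_gt0 : 0 < ln p%:R :> R.
Proof. by rewrite ln_gt0 // ltr1n prime_gt1. Qed.

Lemma ht_le (G1 G2 : gscheme OK) m n : free_of_rank G1 m -> free_of_rank G2 n ->
  (m <= n)%N -> ht p G1 <= ht p G2.
Proof.
move=> G1m G2n mn; rewrite (htE G1m) (htE G2n) ler_pM2r ?invr_gt0 ?lnp_gt0 //.
have m0 := rank_gt0 G1m; have n0 := rank_gt0 G2n.
by rewrite ler_ln ?posrE ?ltr0n // ler_nat.
Qed.

Lemma ht_ge0 (G : gscheme OK) : finite_flat G -> 0 <= ht p G.
Proof.
move=> [n Gn]; rewrite (htE Gn) divr_ge0 ?(ltW lnp_gt0) // ln_ge0 // ler1n.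
exact: rank_gt0 Gn.
Qed.

Section WeakIsogeny.
Variables (G1 G2 : gscheme OK) (phi : ghom G1 G2) (n N d : nat) (u : 'I_d -> G1).
Hypotheses (ff1 : finite_flat G1) (ff2 : finite_flat G2).
Hypotheses (k1 : killed_by (p ^ n) G1) (k2 : killed_by (p ^ n) G2).
Hypothesis phiN : forall B (x : gpoint G1 B), hmap phi x = 0 -> x *+ p ^ N = 0.
Hypothesis ug : cotangent_gens u.

(* The subgroup s is the schematic image of t under phi. *)
Lemma HN_points_image t : HN_points p G1 t ->
  exists2 s, HN_points p G2 s & s.1 <= t.1 /\ t.2 <= s.2 + (N * d)%:R.
Proof.
move=> [G' [iota [ff' iotaS ->]]].
pose psi : ghom G' G2 := comp_hom iota phi.
have psiE b : gh_alg psi b = gh_alg iota (gh_alg phi b) by [].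
have [||Q [pi [piS piK]]] := @quotient_lalg _ G2 [set a | gh_alg psi a = 0]%classic.
- exact: ker_ideal.
- by move=> /= /eqP; rewrite !lrm1 oner_eq0.
have [s1 G2s1] := ff2; have [n' G'n'] := ff'.
have [m mn' Qm] := image_free (@val_ring_total _ _ v) (@val_ring_domain _ _ v)
  G2s1 G'n' piS piK.
have [G'' [iota'' [al [iS G''m alI alE]]]] := image_subgroup piS piK Qm G'n' ff2.
have ff'' : finite_flat G'' by exists m.
exists (ht p G'', deg G''); first by exists G'', iota''; split.
split; first exact: ht_le G''m G'n' mn'.
have alaug z : eps G'' z = 0 -> eps G' (al z) = 0.
  by have [b <-] := iS z; rewrite alE psiE !eps_hom.
apply: (deg_le vp (al := al) (u := fun k => gh_alg iota (u k)) (n := n)) => //.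
- exact: closed_killed k1.
- exact: closed_killed k2.
- move=> x; have [y <-] := iotaS x; rewrite eps_hom => /ug.2[c cE].
  exists c, 0; rewrite !lrm0 subr0; split=> //.
  have := aug_sq_hom (f := gh_alg iota) _ cE; rewrite lrmB lrm_sum.
  under [in X in _ -> X]eq_bigr do rewrite -lrmZ.
  by apply=> z z0; rewrite eps_hom.
- by move=> k; rewrite eps_hom; apply: ug.1.
move=> k; have [w w0 wE] := kernel_aug ff1 phiN (ug.1 k).
exists (gh_alg iota'' w); first by rewrite eps_hom.
rewrite alE psiE -lrmMn -lrmB; apply: (aug_sq_hom _ wE) => z z0.
by rewrite eps_hom.
Qed.

End WeakIsogeny.
End Subgroups.

Section TrivialGroup.
Variable S : comNzRingType.

Lemma base_point_uniq (B : comAlgType S) (x y : {lrmorphism (S^o : comAlgType S) -> B}) :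
  x = y.
Proof.
apply: lrmorphism_ext => a.
have -> : a = a *: (1 : S^o) by rewrite /GRing.scale /= mulr1.
by rewrite !lrmZ !lrm1.
Qed.

Definition base_point (B : comAlgType S) : {lrmorphism (S^o : comAlgType S) -> B} :=
  sval (cid (in_alg_lrmorphism B)).

(** Its closed immersion into every [G] provides the point above 0 required by [spans_strip]. *)
Definition trivial_gscheme : gscheme S :=
  @GScheme S (S^o : comAlgType S) base_point (fun B _ => base_point B)
    (fun B _ _ => base_point B)
    (fun B _ _ _ => erefl) (fun B _ _ => erefl)
    (fun B _ => base_point_uniq _ _) (fun B _ => erefl)
    (fun B C h x y => base_point_uniq _ _).

Lemma trivial_free : free_of_rank trivial_gscheme 1.
Proof.
apply: (@free_of_rank_gens _ S^o _ (fun=> 1)) => [x|c]; last first.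
  by rewrite big_ord1 /GRing.scale /= mulr1 => c0 i; rewrite ord1.
by exists (fun=> x); rewrite big_ord1 /GRing.scale /= mulr1.
Qed.

Fact trivial_hom_add (G : gscheme S) B (x y : Defs.point trivial_gscheme B) :
  lrcomp (gs_add x y) (eps G) = gs_add (lrcomp x (eps G)) (lrcomp y (eps G)).
Proof.
have e0 z : lrcomp z (eps G) = (0 : gpoint G B) :=
  raddf0 (@pmap _ G _ _ z).
by rewrite !e0; apply/esym/(addr0 (0 : gpoint G B)).
Qed.

Definition trivial_hom (G : gscheme S) : ghom trivial_gscheme G :=
  GHom (@trivial_hom_add G).

Lemma trivial_hom_closed G : closed_immersion (trivial_hom G).
Proof.
move=> a; exists a%:A; rewrite lrmZ lrm1.
by rewrite /GRing.scale /= mulr1.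
Qed.

Lemma surj_rank_le (A A' : comAlgType S) (f : {lrmorphism A -> A'}) m n :
  (forall b, exists a, f a = b) -> free_of_rank A m -> free_of_rank A' n -> (n <= m)%N.
Proof.
move=> fS /free_of_rankP[b [co bco]] /free_of_rankP[b' [co' bco']].
have [g gE] := choice (fun i => fS (b' i)).
apply: (@mul_scalar_rank S n m (\matrix_(i, j) co (g i) j)
  (\matrix_(j, i) co' (f (b j)) i) 1).
  apply/matrixP => i k; rewrite !mxE; under eq_bigr do rewrite !mxE.
  rewrite eq_sym -(coord_basis bco') -gE [in RHS](basisE bco (g i)) lrm_sum (coord_sum bco').
  by apply: eq_bigr => j _; rewrite lrmZ (coordZ bco').
by move=> k; rewrite expr1n oner_neq0.
Qed.

End TrivialGroup.

(** * The levels of a p-divisible group *)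

Section PDivisibleGroups.
Variables (S : comNzRingType) (p : nat) (H : pdiv_group S p).

Lemma pd_finite_flat n : finite_flat (H n).
Proof. by exists (p ^ (n * pd_ht H))%N; apply: pd_rank. Qed.

Lemma pd_kernel n B (x : gpoint (H n.+1) B) :
  x *+ p ^ n = 0 <-> exists y, hmap (pd_incl H n) y = x.
Proof. by rewrite -pmulnE; apply: pd_exact. Qed.

Lemma pd_hmap_inj n B : injective (@hmap _ _ _ (pd_incl H n) B).
Proof. exact: pd_incl_inj. Qed.

Lemma pd_killed n : killed_by (p ^ n) (H n).
Proof.
move=> B x; apply: (@pd_hmap_inj n); rewrite raddfMn raddf0 /=.
by apply/pd_kernel; exists x.
Qed.

(** At level 1 the centred vectors of a basis of the algebra generate, so [d] is its rank; each
    further level lifts the generators of the previous one. *)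
Lemma pd_cotangent_gens : exists d, forall n,
  exists u : 'I_d -> H n.+1, cotangent_gens u.
Proof.
have [d Hd] := pd_finite_flat 1.
exists d; elim=> [|n [u ug]]; first exact: cotangent_gens_basis.
apply: (cotangent_gens_lift (M := p ^ n.+1) _ _ _ _ ug).
- exact: pd_hmap_inj.
- exact: pd_kernel.
- exact: pd_finite_flat.
(* With M = p^(n+1), M^2 = p^(2n+2) kills level n + 2. *)
move=> B x; rewrite -expnD addSnnS addnC expnD mulrnA.
by rewrite pd_killed mul0rn.
Qed.

End PDivisibleGroups.

(** * Comparison of polygons level by level *)

Section LevelComparison.
Variables (R : realType) (K : fieldType) (v : valuation K R) (p : nat).
Hypothesis vp : v p%:R = 1%E.
Hypothesis p_pr : prime p.
Local Notation OK := (val_ring v).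

Lemma HN_points_strip (G : gscheme OK) n : finite_flat G -> killed_by (p ^ n) G ->
  spans_strip (ht p G) (HN_points p G).
Proof.
move=> Gff Gk; split.
- move=> _ [G' [iota [ff' iS ->]]] /=; split; [exact: ht_ge0 | | exact: deg_ge0].
  have [m Gm] := Gff; have [m' G'm'] := ff'.
  exact: ht_le G'm' Gm (surj_rank_le iS Gm G'm').
- exists (deg (trivial_gscheme OK)), (trivial_gscheme OK), (trivial_hom G); split.
  + by exists 1%N; apply: trivial_free.
  + exact: trivial_hom_closed.
  + by rewrite (htE _ (trivial_free OK)) ln1 mul0r.
exists (deg G); split.
  by exists G, (id_hom G); split=> // a; exists a.
(* For a closed subgroup omega_G maps onto omega_G', so the degree bound applies with no additional
   generator, N = d = 0. *)
move=> _ [G' [iota [ff' iS ->]]] /=; rewrite -[deg G]addr0 -(mulr0n 1) -(muln0 0).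
apply: (deg_le vp (al := gh_alg iota) (u := fun k : 'I_0 => 0) (n := n)) => //.
- exact: closed_killed Gk.
- by move=> t; rewrite eps_hom.
- move=> x x0; have [y yE] := iS x; exists (fun=> 0), y.
  rewrite -(eps_hom iota) yE; split=> //.
  by rewrite big_ord0 subr0 subrr; apply: aug_sq0.
- by case.
- by case.
Qed.

Lemma pd_htE (H : pdiv_group OK p) n : ht p (H n) = (n * pd_ht H)%:R.
Proof.
rewrite (htE _ (pd_rank H n)) natrX lnXn ?ltr0n ?prime_gt0 //.
by rewrite -[_ *+ _]mulr_natl mulfK // gt_eqF // lnp_gt0.
Qed.

Lemma HN_le (H1 H2 : pdiv_group OK p) n N d (phi : ghom (H1 n) (H2 n))
    (u : 'I_d -> H1 n) x :
  pd_ht H1 = pd_ht H2 ->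
  (forall B (y : gpoint (H1 n) B), hmap phi y = 0 -> y *+ p ^ N = 0) ->
  cotangent_gens u -> 0 <= x <= (n * pd_ht H1)%:R ->
  HN p (H1 n) x <= HN p (H2 n) x + (N * d)%:R.
Proof.
move=> h12 phiN ug /andP[x0 xh]; rewrite /HN !pd_htE -h12.
have s1 := HN_points_strip (pd_finite_flat H1 n) (@pd_killed _ _ H1 n).
have s2 := HN_points_strip (pd_finite_flat H2 n) (@pd_killed _ _ H2 n).
rewrite pd_htE in s1; rewrite pd_htE -h12 in s2.
apply: envelope_le => // t.
apply: (HN_points_image vp p_pr (n := n) _ _ _ _ phiN ug);
  by [apply: pd_finite_flat | apply: pd_killed].
Qed.

(* The limits need not be known to exist: both sequences have the same limits. *)
Lemma HN_pdiv_eq (H1 H2 : pdiv_group OK p) C x :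
  (forall n, `|HN p (H1 n.+1) (n.+1%:R * x) - HN p (H2 n.+1) (n.+1%:R * x)| <= C) ->
  HN_pdiv H1 x = HN_pdiv H2 x.
Proof.
move=> HC; rewrite /HN_pdiv.
pose f (H : pdiv_group OK p) n := n%:R^-1 * HN p (H n) (n%:R * x).
have d0 : ((f H1 - f H2)%R @ \oo --> (0 : R))%classic.
  rewrite -cvg_shiftS; apply/cvgr0Pnorm_le => e e0 /=.
  near=> n; rewrite /f !fctE -mulrBr normrM ger0_norm ?invr_ge0 ?ler0n //.
  rewrite mulrC ler_pdivrMr ?ltr0n // (le_trans (HC n)) // -ler_pdivrMl //.
  rewrite (@le_trans _ _ n%:R) ?ler_nat //.
  by near: n; exact: nbhs_infty_ger.
have eq_lim (l : R) : (f H1 @ \oo --> l)%classic = (f H2 @ \oo --> l)%classic.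
  apply/propext; split=> fl.
    have -> : f H2 = f H1 - (f H1 - f H2) by rewrite subKr.
    have := cvgB fl d0; rewrite subr0; exact.
  have -> : f H1 = f H2 + (f H1 - f H2) by rewrite addrC subrK.
  have := cvgD fl d0; rewrite addr0; exact.
rewrite /lim; congr get; apply/funext => l; exact: eq_lim.
Unshelve. all: by end_near. Qed.
End LevelComparison.

(** * Points in a domain *)

Section PrimeAvoidance.
Variables (T : comNzRingType) (W : set T).
Hypotheses (WM : forall w w', W w -> W w' -> W (w * w')) (W0 : ~ W 0).

Let good : set (set T) := fun L => [/\ forall x y, L x -> L y -> L (x + y),
  forall r x, L x -> L (r * x) & forall w, W w -> ~ L w].

(** An ideal maximal among those disjoint from [W] is prime: if s and t lie outside it, both
    enlarged ideals meet [W], and the product of the two elements found would lie in it. *)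
Lemma prime_avoid : exists P : set T, [/\ ideal P,
  forall s t, P (s * t) -> P s \/ P t & forall w, W w -> ~ P w].
Proof.
have [F Fgood Ftot|P [Pgood Pmax]] := @Zorn_bigcup T good.
  split=> [x y [X FX Xx] [Y FY Yy]|r x [X FX Xx]|w Ww [X FX Xw]].
  - have [XY|YX] := Ftot _ _ FX FY.
      by exists Y => //; have [+ _ _] := Fgood _ FY; apply=> //; apply: XY.
    by exists X => //; have [+ _ _] := Fgood _ FX; apply=> //; apply: YX.
  - by exists X => //; have [_ + _] := Fgood _ FX; apply.
  - by have [_ _ /(_ w Ww)] := Fgood _ FX.
have [PD PM PW] := Pgood.
(* The empty set is allowed in [good], being the union of the empty chain; a maximal member is
   nonempty because the zero ideal is larger. *)
have P0 : P 0.
  have [[y Py]|nP] := pselect (exists x, P x); first by rewrite -(mul0r y); apply: PM.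
  exfalso; apply: (Pmax [set 0]%classic).
    split; first by move=> x Px; case: nP; exists x.
    by move=> /(_ 0 erefl) P0; case: nP; exists 0.
  split=> [x y -> ->|r x ->|w Ww /= wE]; rewrite /= ?addr0 ?mulr0 //.
  by apply: W0; rewrite -wE.
exists P; split=> // s t Pst.
have [Ps|nPs] := pselect (P s); first by left.
have [Pt|nPt] := pselect (P t); first by right.
exfalso.
have ext u : ~ P u -> exists w, W w /\ exists2 a, P a & exists r, w = a + r * u.
  move=> nPu; pose L : set T := fun z => exists2 a, P a & exists r, z = a + r * u.
  apply: contrapT => nW; apply: (Pmax L).
    split; first by move=> a Pa; exists a => //; exists 0; rewrite mul0r addr0.
    move=> /(_ u) H; apply: nPu; apply: H.
    by exists 0 => //; exists 1; rewrite mul1r add0r.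
  split=> [_ _ [a Pa [r ->]] [a' Pa' [r' ->]]|r0 _ [a Pa [r ->]]|w Ww [a Pa [r wE]]].
  - by exists (a + a'); [apply: PD | exists (r + r'); rewrite mulrDl addrACA].
  - by exists (r0 * a); [apply: PM | exists (r0 * r); rewrite mulrDr mulrA].
  - by apply: nW; exists w; split=> //; exists a => //; exists r.
have [w [Ww [a Pa [r wE]]]] := ext s nPs.
have [w' [Ww' [a' Pa' [r' w'E]]]] := ext t nPt.
apply: (PW _ (WM Ww Ww')).
have -> : w * w' = w' * a + ((r * s) * a' + (r * r') * (s * t)).
  by rewrite wE w'E; ring.
by apply: (PD _ _ (PM _ _ Pa) (PD _ _ (PM _ _ Pa') (PM _ _ Pst))).
Qed.

End PrimeAvoidance.

Section Points.
Variable S : comNzRingType.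
Implicit Types (G : gscheme S) (B : comAlgType S).

Definition no_zero_divisors B := forall x y : B, x * y = 0 -> x = 0 \/ y = 0.

Lemma nzd_exp B (x : B) k : no_zero_divisors B -> x != 0 -> x ^+ k != 0.
Proof.
move=> dom x0; elim: k => [|k IH]; first by rewrite expr0 oner_neq0.
rewrite exprS; apply/eqP => /dom[] /eqP; apply/negP => //.
Qed.

Lemma scale_natX B M n : (M%:R ^+ n : S)%:A = M%:R ^+ n :> B.
Proof. by rewrite -[LHS]/(in_alg B _) rmorphXn rmorph_nat. Qed.

(* ebar is a multiple of the idempotent that splits off the zero section. *)
Lemma augmentation_annihilator G n M : free_of_rank G n -> killed_by M G ->
  exists ebar : G, eps G ebar = M%:R ^+ n /\ forall a, eps G a = 0 -> ebar * a = 0.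
Proof.
move=> Gn GM; have Gff : finite_flat G by exists n.
have [b [co bco]] := (free_of_rankP _ _).1 Gn.
pose h k := b k - (eps G (b k))%:A.
have hI x : eps G x = 0 -> x = \sum_k co x k *: h k.
  by move=> x0; rewrite aug_basis // x0 scale0r subr0.
have h0 k : eps G (h k) = 0 by apply: eps_sub.
have /choice[Y YE] i : exists y : 'I_n -> G, (forall l, eps G (y l) = 0) /\
    h i *+ M = \sum_l y l * h l.
  have [m [s [t [st ->]]]] := killed_aug Gff GM (h0 i).
  exists (fun l => \sum_j co (t j) l *: s j); split=> [l|].
    rewrite lrm_sum big1 // => j _; have [sj _] := st j.
    by rewrite lrmZ [eps G _]sj scaler0.
  under [RHS]eq_bigr do rewrite mulr_suml.
  rewrite exchange_big; apply: eq_bigr => j _; have [_ tj] := st j.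
  rewrite [in LHS](hI _ tj) mulr_sumr; apply: eq_bigr => l _.
  by rewrite -scalerAr -scalerAl.
(* Determinant trick: [Z] kills the column of the [h l], so its determinant kills each of them by
   the adjugate identity. Under the counit [Z] becomes the scalar [M], whence the value M^n. *)
pose Z : 'M[G]_n := M%:R%:M - \matrix_(i, l) Y i l.
have Zh : Z *m \col_l h l = 0.
  apply/colP => i; rewrite mulmxBl mul_scalar_mx !mxE.
  under eq_bigr do rewrite !mxE.
  by rewrite -(YE i).2 mulr_natl subrr.
exists (\det Z); split.
  rewrite -[LHS]/((eps G : {rmorphism _ -> _}) (\det Z)) -det_map_mx.
  rewrite -det_scalar; congr (\det _); apply/matrixP => i l.
  rewrite !mxE -[LHS]/(eps G (M%:R *+ (i == l) - Y i l)).
  rewrite lrmB (YE i).1 subr0 !lrmMn lrm1.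
  by [].
move=> a /hI ->; rewrite mulr_sumr big1 // => l _.
rewrite -scalerAr; suff -> : \det Z * h l = 0 by rewrite scaler0.
have : \adj Z *m (Z *m \col_l h l) = 0 by rewrite Zh mulmx0.
by rewrite mulmxA mul_adj_mx mul_scalar_mx => /colP/(_ l); rewrite !mxE.
Qed.

(** Distinct points give some [a] in the augmentation ideal with (x - y)(a) nonzero, while e a = 0;
    in a domain the other factor vanishes. *)
Lemma annihilator_separates G B (e : G) (x y : gpoint G B) :
  no_zero_divisors B -> (forall a, eps G a = 0 -> e * a = 0) -> x <> y -> (x - y) e = 0.
Proof.
move=> dom eI xy; have [a [a0 wa]] : exists a, eps G a = 0 /\ (x - y) a <> 0.
  apply: contrapT => H; apply: xy; apply/eqP; rewrite -subr_eq0; apply/eqP.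
  by apply: point_eq0 => a a0; apply: contrapT => wa; apply: H; exists a.
have : (x - y) e * (x - y) a = 0 by rewrite -lrmM eI // lrm0.
by move=> /dom[].
Qed.

Section Bound.
Variables (G : gscheme S) (m p n : nat) (B : comAlgType S).
Hypotheses (Gm : free_of_rank G m) (Gk : killed_by (p ^ n) G).
Hypotheses (dom : no_zero_divisors B) (p0 : p%:R != 0 :> B).

(** The matrix of the values (x i - x j)(e) is a nonzero scalar matrix, since [e] vanishes off the
    zero point. The coproduct of [e] factors it through [m] columns. *)
Lemma points_rank r (x : 'I_r -> gpoint G B) : injective x -> (r <= m)%N.
Proof.
move=> xI; have [e [e_eps eI]] := augmentation_annihilator Gm Gk.
have [l /(_ e)[s sE]] := comult Gm.
apply: (@mul_scalar_rank B r m (\matrix_(i, k) x i (l k))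
  (\matrix_(k, j) (- x j) (s k)) ((p ^ n)%:R ^+ m)); last first.
  by move=> k; rewrite nzd_exp // nzd_exp // natrX nzd_exp.
apply/matrixP => i j; rewrite !mxE; under eq_bigr do rewrite !mxE.
rewrite -sE; case: eqVneq => [->|ij].
  by rewrite subrr zero_pointE e_eps scale_natX.
rewrite mulr0n; apply: annihilator_separates => //.
by move=> /xI/eqP; apply/negP.
Qed.

End Bound.

Section Splitting.
Variables (G : gscheme S) (m p n : nat).
Hypotheses (Gm : free_of_rank G m) (Gk : killed_by (p ^ n) G).

(* Over T = G (x) B, the annihilator of the point x i translates to eb i; after
   inverting p the eb i are orthogonal idempotents and rho is the complement of
   their sum. It is nonzero since r < m, and a prime of T that does not contain
   it gives a point distinct from all the x i. *)
Lemma points_step (B : comAlgType S) r (x : 'I_r -> gpoint G B) :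
  no_zero_divisors B -> p%:R != 0 :> B -> injective x -> (r < m)%N ->
  exists (B' : comAlgType S) (x' : 'I_r.+1 -> gpoint G B'),
    [/\ no_zero_divisors B', p%:R != 0 :> B' & injective x'].
Proof.
move=> dom p0 xI rm; have [e [e_eps eI]] := augmentation_annihilator Gm Gk.
set M := (p ^ n)%N in e_eps.
have [b [co bco]] := (free_of_rankP _ _).1 Gm.
have [T [i1 [i2 [tc [tcK Ktc]]]]] := tensor_exists B bco.
pose D : B := M%:R ^+ m.
have D0 : D != 0 by rewrite nzd_exp // natrX nzd_exp.
have tc2 y t : tc (i2 y * t) =1 (fun i => y * tc t i).
  move=> i; rewrite -[RHS](Ktc (fun i => y * tc t i)) [in LHS](tcK t) mulr_sumr.
  by congr (tc _ i); apply: eq_bigr => j _; rewrite lrmM mulrCA.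
have tc_inj t t' : tc t =1 tc t' -> t = t'.
  by move=> tt; rewrite (tcK t) (tcK t'); apply: eq_bigr => i _; rewrite tt.
have tc1 i k : tc (i1 (b i)) k = (k == i)%:R.
  rewrite -[RHS](Ktc (fun j => (j == i)%:R)); congr (tc _ k).
  rewrite (bigD1 i) //= eqxx lrm1 mulr1 big1 ?addr0 // => j /negbTE ->.
  by rewrite lrm0 mulr0.
have tcD t t' i : tc (t + t') i = tc t i + tc t' i.
  rewrite -[RHS](Ktc (fun i => tc t i + tc t' i)); congr (tc _ i).
  rewrite {1}(tcK t) {1}(tcK t') -big_split; apply: eq_bigr => j _.
  by rewrite lrmD mulrDr.
have tc0 i : tc 0 i = 0 by apply: (addrI (tc 0 i)); rewrite -tcD !addr0.
have tc_sum I (s : seq I) F i : tc (\sum_(j <- s) F j) i = \sum_(j <- s) tc (F j) i.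
  by elim/big_rec2: _ => [//|j y z _ <-]; rewrite tcD.
pose u i : gpoint G T := pmap i1 (idp G) - pmap i2 (x i).
pose eb i : T := u i e.
have /choice[xt xtE] i := tensor_univ (x i) (idfun : {lrmorphism B -> B}) bco tcK Ktc.
have xt1 i a : xt i (i1 a) = x i a by rewrite -lrcompE (xtE i).1.
have xt2 i y : xt i (i2 y) = y by rewrite -lrcompE (xtE i).2.
have eb1 i a : i1 a * eb i = i2 (x i a) * eb i.
  (* The two points of the claim are u i + x i and 0 + x i. Their expansions differ by terms with a
     factor [u i] of an element of the augmentation ideal, killed by [eb i], the value of [u i] at
     [e]. *)
  have [l /(_ a)[s sE]] := comult Gm.
  have := sE T (u i) (pmap i2 (x i)); rewrite subrK pmapE => ->.
  have := sE T 0 (pmap i2 (x i)); rewrite add0r pmapE => ->.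
  rewrite !mulr_suml; apply: eq_bigr => k _.
  rewrite mulrAC [in RHS]mulrAC; congr (_ * _).
  have [a' a'0 ->] := aug_decomp (l k).
  rewrite !lrmD !lrmZ !lrm1 [(0 : gpoint G T) a']zero_pointE a'0 scale0r addr0.
  by rewrite mulrDl /eb -lrmM [a' * e]mulrC eI // lrm0 addr0.
have ebt i t : t * eb i = i2 (xt i t) * eb i.
  rewrite {1 2}(tcK t) !lrm_sum !mulr_suml; apply: eq_bigr => k _.
  by rewrite mulrAC eb1 mulrAC -lrmM [xt i (_ * _)]lrmM xt1 xt2.
have xt_eb i j : xt i (eb j) = if i == j then D else 0.
  rewrite /eb -pmapE raddfB /= !pmap_comp (xtE i).1 pmap_idp.
  have -> : lrcomp (xt i) i2 = idfun := (xtE i).2.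
  have -> : pmap (idfun : {lrmorphism B -> B}) (x j) = x j by apply: lrmorphism_ext.
  case: eqVneq => [->|ij].
    by rewrite subrr zero_pointE e_eps scale_natX.
  apply: annihilator_separates => //.
  by move=> /xI/eqP; apply/negP.
pose rho : T := i2 D - \sum_i eb i.
have rho_eb i : rho * eb i = 0.
  rewrite mulrBl mulr_suml (bigD1 i) //= (ebt i (eb i)) xt_eb eqxx.
  rewrite big1 ?addr0 ?subrr // => j ji; rewrite (ebt i (eb j)) xt_eb.
  by rewrite eq_sym (negbTE ji) lrm0 mul0r.
have rho2 : rho * rho = i2 D * rho.
  rewrite {1}/rho mulrBl mulr_suml big1 ?subr0 // => i _.
  by rewrite mulrC rho_eb.
have rho0 : rho <> 0.
  (* If [rho] vanished, multiplication by [D] on the rank [m] module [T] over [B] would factor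
     through the [r] values at the points [x i]. *)
  move=> rho0; have DE : i2 D = \sum_i eb i by apply/eqP; rewrite -subr_eq0; apply/eqP.
  have : (m <= r)%N; last by rewrite leqNgt rm.
  apply: (@mul_scalar_rank B m r (\matrix_(l, i) x i (b l))
    (\matrix_(i, k) tc (eb i) k) D); last by move=> k; apply: nzd_exp.
  apply/matrixP => l k; rewrite !mxE; under eq_bigr do rewrite !mxE -tc2 -eb1.
  rewrite -tc_sum -mulr_sumr -DE mulrC tc2 tc1 mulr_natr.
  by rewrite (eq_sym k l).
(* Avoiding these multiples makes the quotient contain [B] and keeps [rho] nonzero in it; the set is
   multiplicative because [rho] squared is [D] times [rho]. *)
pose W : set T := [set w | exists2 y, y != 0 & w = i2 y * rho]%classic.
have nz y z : y != 0 -> z != 0 -> y * z != 0 :> B.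
  by move=> y0 z0; apply/eqP => /dom[] /eqP; apply/negP.
have WM w w' : W w -> W w' -> W (w * w').
  move=> [y y0 ->] [z z0 ->]; exists (y * z * D); first by rewrite !nz.
  by rewrite mulrACA rho2 mulrA !lrmM.
have W0 : ~ W 0.
  move=> [y y0 yE]; apply: rho0; apply: tc_inj => i; rewrite tc0.
  have := tc2 y rho i; rewrite -yE tc0 => /esym/dom[/eqP|//].
  by rewrite (negbTE y0).
have Wne : exists w, W w by exists (i2 1 * rho); exists 1; rewrite ?oner_neq0.
have [P [Pid Pprime PW]] := prime_avoid WM W0.
have [_ _ PM] := Pid.
have P1 : ~ P 1.
  move=> P1; have [w Ww] := Wne; apply: (PW w Ww).
  by rewrite -(mulr1 w); apply: PM.
have [Q [q [qS qK]]] := quotient_lalg Pid P1.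
have qi2 y : q (i2 y) = 0 -> y = 0.
  move=> /qK Py; apply/eqP/negP => /negP y0; apply: (PW (i2 y * rho)).
    by exists y.
  by rewrite mulrC; apply: PM.
have qrho : q rho <> 0.
  move=> /qK Prho; apply: (PW (i2 1 * rho)); first by exists 1; rewrite ?oner_neq0.
  exact: PM.
pose h : {lrmorphism B -> Q} := lrcomp q i2.
have hI : injective h.
  move=> y z yz; apply/eqP; rewrite -subr_eq0; apply/eqP/qi2.
  by rewrite -lrcompE -/h lrmB yz subrr.
(* If the new point equalled [x i], then [eb i] would become its value [D] at the zero point,
   contradicting [rho_eb] in a domain. *)
have hx i : pmap q (pmap i1 (idp G)) <> pmap h (x i).
  move=> E; apply: qrho; have : q rho * q (i2 D) = 0.
    have <- : q (eb i) = q (i2 D).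
      rewrite /eb -pmapE raddfB /= E [pmap q (pmap i2 _)]pmap_comp subrr.
      rewrite zero_pointE e_eps scale_natX /D.
      by rewrite -!natrX -[i2 _]/(i2 (1 *+ _)) !lrmMn !lrm1.
    by rewrite -lrmM rho_eb lrm0.
  have [s sE] := qS (q rho); rewrite -lrmM => /qK/Pprime[/qK //|/qK/qi2 D00].
  by move: D0; rewrite D00 eqxx.
exists Q, (fun k => if unlift ord_max k is Some i then pmap h (x i)
  else pmap q (pmap i1 (idp G))); split.
- move=> y z; have [y' <-] := qS y; have [z' <-] := qS z.
  by rewrite -lrmM => /qK/Pprime[] /qK; [left | right].
- apply/eqP => pQ; move/eqP: p0; apply; apply: hI.
  by rewrite lrm0 -pQ lrmMn lrm1.
move=> k k'; case: unliftP => [i ->|->]; case: unliftP => [j ->|->] //.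
- by move=> /(pmap_inj hI)/xI ->.
- by move=> /esym/hx.
- by move=> /hx.
Qed.

Lemma points_exist :
  (forall x y : S, x * y = 0 -> x = 0 \/ y = 0) -> p%:R != 0 :> S ->
  exists (B : comAlgType S) (x : 'I_m -> gpoint G B),
    [/\ no_zero_divisors B, p%:R != 0 :> B & injective x].
Proof.
move=> domS p0.
have : forall r, (r <= m)%N -> exists (B : comAlgType S) (x : 'I_r -> gpoint G B),
    [/\ no_zero_divisors B, p%:R != 0 :> B & injective x].
  elim=> [_|r IH rm]; last first.
    by have [B [x [dom pB xI]]] := IH (ltnW rm); apply: points_step xI rm.
  by exists (S^o : comAlgType S), (fun=> 0); split=> // -[].
exact.
Qed.

End Splitting.
End Points.

(** * Fppf descent *)

Section Descent.
Variable S : comNzRingType.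
Variables (B C : comAlgType S) (h : {lrmorphism B -> C}).

(** Induction on the equations: each new relation is rewritten in the parameters [d] that solve the
    previous ones, and flatness solves it for those parameters. *)
Lemma flat_system (I J : finType) (q : J -> I -> B) (c : I -> C) :
  Defs.flat_map h -> (forall j, \sum_i h (q j i) * c i = 0) ->
  exists (m : nat) (a : I -> 'I_m -> B) (d : 'I_m -> C),
    (forall i, c i = \sum_t h (a i t) * d t) /\
    (forall j t, \sum_i q j i * a i t = 0).
Proof.
move=> hflat qc.
suff [m [a [d [cE qa]]]] : exists (m : nat) (a : I -> 'I_m -> B) (d : 'I_m -> C),
    (forall i, c i = \sum_t h (a i t) * d t) /\
    (forall j t, j \in enum J -> \sum_i q j i * a i t = 0).
  by exists m, a, d; split=> // j t; apply: qa; rewrite mem_enum.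
elim: (enum J) => [|j s [m [a [d [cE qa]]]]].
  exists #|I|, (fun i t => (t == enum_rank i)%:R), (fun t => c (enum_val t)).
  split=> // i; rewrite (bigD1 (enum_rank i)) //= eqxx lrm1 mul1r enum_rankK.
  by rewrite big1 ?addr0 // => t /negbTE->; rewrite lrm0 mul0r.
have [|m' [a' [d' [dE qa']]]] := hflat m (fun t => \sum_i q j i * a i t) d.
  rewrite -[RHS](qc j); under [RHS]eq_bigr do rewrite cE mulr_sumr.
  rewrite exchange_big; apply: eq_bigr => t _ /=; rewrite lrm_sum mulr_suml.
  by apply: eq_bigr => i _; rewrite lrmM mulrA.
exists m', (fun i l => \sum_t a i t * a' t l), d'; split=> [i|j' l].
  rewrite cE; under eq_bigr do rewrite dE mulr_sumr.
  rewrite exchange_big; apply: eq_bigr => l _ /=; rewrite lrm_sum mulr_suml.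
  by apply: eq_bigr => t _; rewrite lrmM mulrA.
rewrite inE; under eq_bigr do rewrite mulr_sumr.
rewrite exchange_big /= => /orP[/eqP->|j's].
  rewrite -[RHS](qa' l); apply: eq_bigr => t _; rewrite mulr_suml.
  by apply: eq_bigr => i _; rewrite mulrA.
rewrite big1 // => t _; under eq_bigr do rewrite mulrA.
by rewrite -mulr_suml qa // mul0r.
Qed.

Section Pushout.
Variables (k l : nat) (u : 'I_k -> C) (F : 'I_l -> mpoly.mpoly k B).
Hypothesis uF : forall P : mpoly.mpoly k B, mpoly.mmap h u P = 0 <->
  exists Q : 'I_l -> mpoly.mpoly k B, P = \sum_j Q j * F j.
Hypotheses (hflat : Defs.flat_map h) (hfaith : faithful_map h).
Variables (B' : comAlgType S) (theta : {lrmorphism B -> B'}).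
Local Notation thX := (@mpoly.map_mpoly k B B' theta).

(* The relations express that b' (x) 1 = 1 (x) P(u) in B' (x)_B C; they lift along
   the flat extension C to relations with coefficients in B. *)
Lemma descent (b' : B') (P : mpoly.mpoly k B) (G : 'I_l -> mpoly.mpoly k B') :
  mpoly.mpolyC k b' - thX P = \sum_j G j * thX (F j) ->
  (exists q, b' = theta q) /\ (P = 0 -> b' = 0).
Proof.
move=> GE.
(* Degree bounds make the monomials finite in number: [d'] bounds the [G j], and [d] below bounds
   [P] and the monomial multiples of the [F j]. The 1 in [d] ensures that the constant monomial is
   an index. *)
pose d' := (\max_j mpoly.msize (G j))%N.
pose J := ('I_l * mpoly.bmultinom k d')%type.
pose r (s : J) : mpoly.mpoly k B := mpoly.mpolyX B s.2 * F s.1.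
pose g (s : J) : B' := mpoly.mcoeff s.2 (G s.1).
pose d := maxn 1 (maxn (mpoly.msize P) (\max_s mpoly.msize (r s))).
pose I := mpoly.bmultinom k d.
pose q (s : J) (i : I) : B := mpoly.mcoeff i (r s).
have rE s : \sum_i h (q s i) * mpoly.mmap1 u i = 0.
  rewrite -mpoly.mmapE; last first.
    by rewrite /d !leq_max (@leq_bigmax _ (fun s => mpoly.msize (r s)) s) !orbT.
  apply/uF; exists (fun j => if j == s.1 then mpoly.mpolyX B s.2 else 0).
  rewrite (bigD1 s.1) //= eqxx big1 ?addr0 // => j /negbTE ->.
  by rewrite mul0r.
have [m [a [e [uE qa]]]] := flat_system hflat rE.
have coefE (i : mpoly.multinom k) : b' * (i == mpoly.mnm0)%:R - theta (mpoly.mcoeff i P) =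
    \sum_s g s * theta (mpoly.mcoeff i (r s)).
  have thXE s : g s *: thX (r s) = g s *: mpoly.mpolyX B' s.2 * thX (F s.1).
    by rewrite /r rmorphM /= mpoly.map_mpolyX scalerAl.
  have := congr1 (mpoly.mcoeff i) GE.
  rewrite raddfB /= mpoly.mcoeffC mpoly.mcoeff_map_mpoly => ->.
  have -> : \sum_j G j * thX (F j) = \sum_s g s *: thX (r s).
    under [RHS]eq_bigr do rewrite thXE.
    rewrite -(pair_big xpredT xpredT (fun j m => mpoly.mcoeff (mpoly.bmnm m) (G j) *:
      mpoly.mpolyX B' (mpoly.bmnm m) * thX (F j))) /=.
    apply: eq_bigr => j _; rewrite -mulr_suml -mpoly.mpolywE //.
    exact: (@leq_bigmax _ (fun j => mpoly.msize (G j))).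
  rewrite raddf_sum; apply: eq_bigr => s _ /=.
  by rewrite mpoly.mcoeffZ mpoly.mcoeff_map_mpoly.
have d0 : (0 < d)%N by rewrite /d leq_max.
have mdeg0 : (mpoly.mdeg (mpoly.mnm0 : mpoly.multinom k) < d)%N.
  by rewrite mpoly.mdeg0.
pose i0 : I := mpoly.BMultinom mdeg0.
pose q' t := \sum_(i : I) mpoly.mcoeff i P * a i t.
(* Pairing the coefficients of the given identity with the solution [a] kills the right-hand side,
   as each multiple of an [F j] is a relation solved by [a]. *)
have b'a t : b' * theta (a i0 t) = theta (q' t).
  apply/eqP; rewrite -subr_eq0; apply/eqP.
  transitivity (\sum_(i : I) (b' * (mpoly.bmnm i == mpoly.mnm0)%:R -
      theta (mpoly.mcoeff i P)) * theta (a i t)).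
    under [RHS]eq_bigr do rewrite mulrBl.
    rewrite sumrB; congr (_ - _).
      rewrite (bigD1 i0) //= eqxx mulr1 big1 ?addr0 // => i ii0.
      suff /negbTE -> : mpoly.bmnm i != mpoly.mnm0 by rewrite mulr0 mul0r.
      by apply: contra_neq ii0 => ii0; apply: val_inj.
    by rewrite lrm_sum; apply: eq_bigr => i _; rewrite lrmM.
  under eq_bigr do rewrite coefE mulr_suml.
  rewrite exchange_big big1 // => s _ /=.
  transitivity (g s * theta (\sum_i q s i * a i t)).
    by rewrite lrm_sum mulr_sumr; apply: eq_bigr => i _; rewrite lrmM mulrA.
  by rewrite qa lrm0 mulr0.
(* The constant monomial takes the value 1 at [u], so the [a i0 t] generate the unit ideal over [C];
   faithfulness brings this down to [B]. *)
have [w wE] : exists w : 'I_m -> B, \sum_t a i0 t * w t = 1.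
  apply: hfaith; exists e; rewrite -uE.
  exact: mpoly.mmap11.
have b'E : b' = theta (\sum_t q' t * w t).
  rewrite -[LHS]mulr1 -(lrm1 theta) -wE !lrm_sum mulr_sumr.
  by apply: eq_bigr => t _; rewrite !lrmM mulrA b'a.
split; first by exists (\sum_t q' t * w t).
move=> P0; rewrite b'E big1 ?lrm0 // => t _.
by rewrite /q' big1 ?mul0r // => i _; rewrite P0 mpoly.mcoeff0 mul0r.
Qed.

End Pushout.

(* D = B'[X]/(F), where C = B[X]/(F). *)
Lemma fppf_pushout (B' : comAlgType S) (theta : {lrmorphism B -> B'}) :
  fppf_map h ->
  exists (D : comAlgType S) (c1 : {lrmorphism B' -> D}) (c2 : {lrmorphism C -> D}),
    [/\ lrcomp c1 theta = lrcomp c2 h, injective c1 &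
        forall b' c, c1 b' = c2 c -> exists b, b' = theta b].
Proof.
move=> [hflat hfaith [k [u [uS [l [F uF]]]]]].
pose thX := (@mpoly.map_mpoly k B B' theta).
pose R' := mpoly.mpoly k B'.
pose J : set R' := [set z | exists G : 'I_l -> R', z = \sum_j G j * thX (F j)]%classic.
have Jid : ideal J.
  split=> [|_ _ [G ->] [G' ->]|r _ [G ->]].
  - by exists (fun=> 0); rewrite big1 // => j _; rewrite mul0r.
  - exists (fun j => G j + G' j); rewrite -big_split.
    by apply: eq_bigr => j _; rewrite mulrDl.
  - exists (fun j => r * G j); rewrite mulr_sumr.
    by apply: eq_bigr => j _; rewrite mulrA.
have desc b' (P : mpoly.mpoly k B) : J (mpoly.mpolyC k b' - thX P) ->
    (exists q, b' = theta q) /\ (P = 0 -> b' = 0).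
  by move=> [G GE]; exact: (descent uF hflat hfaith GE).
have descC b' : J (mpoly.mpolyC k b') -> b' = 0.
  move=> Jb; have [|_ b'0] := desc b' 0; first by rewrite /thX rmorph0 subr0.
  exact: b'0.
have J1 : ~ J 1.
  move=> J1'; have /eqP[] := oner_neq0 B'; apply: descC.
  by rewrite rmorph1.
pose eta : {rmorphism S -> R'} := @mpoly.mpolyC k B' \o in_alg B'.
have [D [pi [piS piK piZ]]] := quotient_alg eta Jid J1.
have [] := @lrmorphism_of S B' D (fun b' => pi (mpoly.mpolyC k b')).
- by move=> x y; rewrite !rmorphD.
- move=> s x; rewrite -[s *: x]mulr_algl !rmorphM.
  by rewrite [X in X * _]piZ mulr_algl.
- by rewrite !rmorph1.
- by move=> x y; rewrite !rmorphM.
move=> c1 c1E.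
have [rep repE] := choice uS.
have wd (P P' : mpoly.mpoly k B) : mpoly.mmap h u P = mpoly.mmap h u P' ->
    pi (thX P) = pi (thX P').
  move=> PP'; apply/eqP; rewrite -subr_eq0 -rmorphB -rmorphB /=; apply/eqP/piK.
  have [|Q ->] := (uF (P - P')).1; first by rewrite rmorphB /= PP' subrr.
  exists (fun j => thX (Q j)); rewrite rmorph_sum.
  by apply: eq_bigr => j _; rewrite rmorphM.
have c1th b : c1 (theta b) = pi (thX (mpoly.mpolyC k b)).
  by rewrite c1E /thX mpoly.map_mpolyC.
pose f c := pi (thX (rep c)).
have fh b : f (h b) = c1 (theta b).
  by rewrite c1th; apply: wd; rewrite repE mpoly.mmapC.
have fM : {morph f : x y / x * y}.
  move=> x y; rewrite /f -!rmorphM /=; apply: wd.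
  by rewrite rmorphM /= !repE.
have [] := @lrmorphism_of S C D f.
- move=> x y; rewrite /f -!rmorphD /=; apply: wd.
  by rewrite rmorphD /= !repE.
- move=> s x; rewrite -[s *: x]mulr_algl fM.
  have -> : s%:A = h s%:A :> C by rewrite lrmZ lrm1.
  by rewrite fh !lrmZ !lrm1 mulr_algl.
- by rewrite -(lrm1 h) fh !lrm1.
- exact: fM.
move=> c2 c2E; exists D, c1, c2; split.
- by apply: lrmorphism_ext => b; rewrite !lrcompE c2E fh.
- move=> x y xy; apply/eqP; rewrite -subr_eq0; apply/eqP/descC/piK.
  by have := c1E (x - y); rewrite lrmB xy subrr => <-.
move=> b' c; rewrite c2E c1E => e.
have [|//] := desc b' (rep c); apply/piK.
by rewrite rmorphB /= e subrr.
Qed.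

End Descent.

(** * Isogenies *)

Section Towers.
Variables (S : comNzRingType) (p : nat).
Implicit Types (H : pdiv_group S p) (B C : comAlgType S).

Fixpoint pd_inc H k n : ghom (H n) (H (k + n)%N) :=
  if k is k'.+1 then comp_hom (pd_inc H k' n) (pd_incl H (k' + n)) else id_hom (H n).

Lemma pd_transE H k n B (x : gpoint (H n) B) : pd_trans k x = hmap (pd_inc H k n) x.
Proof.
elim: k => [|k IH]; first by rewrite hmap_id.
by rewrite hmap_comp -IH.
Qed.

Lemma pd_inc_inj H k n B : injective (@hmap _ _ _ (pd_inc H k n) B).
Proof.
elim: k => [|k IH] x y; first by rewrite !hmap_id.
by rewrite !hmap_comp => /pd_hmap_inj/IH.
Qed.

Lemma pd_inc_torsion H k n B (x : gpoint (H (k + n)%N) B) : x *+ p ^ n = 0 ->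
  exists y, hmap (pd_inc H k n) y = x.
Proof.
elim: k x => [|k IH] x xn; first by exists x; rewrite hmap_id.
have [|z zx] := (pd_kernel x).1; first by rewrite expnD mulnC mulrnA xn mul0rn.
have [|y yz] := IH z; last by exists y; rewrite hmap_comp yz.
by apply: (@pd_hmap_inj _ _ H (k + n)); rewrite raddfMn /= zx xn raddf0.
Qed.

Lemma ph_inc H1 H2 (f : pd_hom H1 H2) k n B (x : gpoint (H1 n) B) :
  hmap (f (k + n)%N) (hmap (pd_inc H1 k n) x) = hmap (pd_inc H2 k n) (hmap (f n) x).
Proof.
elim: k => [|k IH]; first by rewrite !hmap_id.
by rewrite !hmap_comp -IH; apply: ph_incl.
Qed.

Lemma lift_lrmorphism (A B C : comAlgType S) (h : {lrmorphism B -> C})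
    (z : {lrmorphism A -> C}) : injective h -> (forall a, exists b, z a = h b) ->
  exists w : {lrmorphism A -> B}, lrcomp h w = z.
Proof.
move=> hI /choice[w wE].
have [] := @lrmorphism_of S A B w.
- by move=> x y; apply: hI; rewrite -wE !lrmD !wE.
- by move=> s x; apply: hI; rewrite -wE !lrmZ !wE.
- by apply: hI; rewrite -wE !lrm1.
- by move=> x y; apply: hI; rewrite -wE !lrmM !wE.
by move=> g gE; exists g; apply: lrmorphism_ext => a; rewrite lrcompE gE wE.
Qed.

Section QuasiInverse.
Variables (H1 H2 : pdiv_group S p) (f : pd_hom H1 H2) (N : nat).
Hypothesis fepi : fppf_epi f.
Hypothesis fker : forall n B (x : gpoint (H1 n) B), hmap (f n) x = 0 -> x *+ p ^ N = 0.

(* The quasi-inverse is p^N f^-1: by fppf descent, p^N x only depends on f x.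
   Only lifts of one universal point are compared, so that all of them live at
   the same level k + n. *)
Lemma quasi_inverse n : exists g : ghom (H2 n) (H1 n),
  forall B (y : gpoint (H2 n) B), hmap (f n) (hmap g y) = y *+ p ^ N.
Proof.
have [C [h [hfppf [k [x0 x0E]]]]] := fepi (idp (H2 n)).
pose x : gpoint (H1 (k + n)%N) C := x0.
have xE : hmap (f (k + n)%N) x = hmap (pd_inc H2 k n) (pmap h (idp (H2 n))).
  by rewrite -pmap_hmap -pd_transE; apply: x0E.
have hI : injective h.
  have [D [c1 [c2 [ce c1I _]]]] := fppf_pushout (idfun : {lrmorphism H2 n -> H2 n}) hfppf.
  move=> a b ab; apply: c1I.
  have e t : c1 t = c2 (h t) by rewrite -[RHS]lrcompE -ce.
  by rewrite !e ab.
(* The image of p^n x under f is zero, since it comes from level n of [H2]. So p^N kills p^n x, and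
   p^N x descends to level n of [H1]. *)
have [|z' z'E] := @pd_inc_torsion H1 k n C (x *+ p ^ N).
  rewrite mulrnAC; apply: fker; rewrite raddfMn /= xE -raddfMn /= pd_killed.
  exact: raddf0.
have [z zE] : exists z : {lrmorphism H1 n -> H2 n}, lrcomp h z = z'.
  apply: lift_lrmorphism => // a.
  (* Over the pushout of [h] with itself, the two images of [x] have the same image under f, so
     their multiples by p^N agree; [cB] then gives the descent from [C]. *)
  have [D [c1 [c2 [ce _ cB]]]] := fppf_pushout h hfppf.
  apply: (cB _ (z' a)).
  suff e : pmap c1 z' = pmap c2 z' by rewrite -!pmapE e.
  apply: (@pd_inc_inj H1 k n); rewrite -!pmap_hmap z'E !raddfMn /=.
  apply/eqP; rewrite -subr_eq0 -mulrnBl; apply/eqP/fker.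
  by rewrite raddfB /= -!pmap_hmap xE !pmap_hmap !pmap_comp ce subrr.
have zD B (y1 y2 : Defs.point (H2 n) B) : lrcomp (gs_add y1 y2) z =
    gs_add (lrcomp y1 z) (lrcomp y2 z).
  pose y3 : gpoint (H2 n) B := (y1 : gpoint _ _) + (y2 : gpoint _ _).
  (* Three successive covers, one each for [y1], [y2] and [y3], give a ring [D3] containing [B] over
     which all three lift through [x]. There additivity follows from the kernel bound on f. *)
  have [D1 [c1 [e1 [ce1 c1I _]]]] := fppf_pushout y1 hfppf.
  have [D2 [c2 [e2 [ce2 c2I _]]]] := fppf_pushout (lrcomp c1 y2) hfppf.
  have [D3 [c3 [e3 [ce3 c3I _]]]] := fppf_pushout (lrcomp (lrcomp c2 c1) y3) hfppf.
  pose j := lrcomp c3 (lrcomp c2 c1).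
  have jI : injective j by move=> a b /c3I/c2I/c1I.
  have cover (y : gpoint (H2 n) B) (e : {lrmorphism C -> D3}) : lrcomp e h = pmap j y ->
      hmap (f (k + n)%N) (pmap e x) = hmap (pd_inc H2 k n) (pmap j y) /\
      hmap (pd_inc H1 k n) (pmap j (pmap y (z : gpoint (H1 n) (H2 n)))) = pmap e x *+ p ^ N.
    move=> eh; split.
      by rewrite -pmap_hmap xE pmap_hmap pmap_comp eh pmap_idp.
    rewrite pmap_comp -[lrcomp j y]/(pmap j y) -eh.
    have -> : pmap (lrcomp e h) (z : gpoint (H1 n) (H2 n)) = pmap e z'.
      by rewrite -zE; apply/esym/lrcompA.
    by rewrite -pmap_hmap z'E raddfMn.
  have [|f1 g1] := cover y1 (lrcomp c3 (lrcomp c2 e1)).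
    by rewrite -!lrcompA -ce1; apply: lrmorphism_ext.
  have [|f2 g2] := cover y2 (lrcomp c3 e2).
    by rewrite -lrcompA -ce2; apply: lrmorphism_ext.
  have [|f3 g3] := cover y3 e3; first by rewrite -ce3; apply: lrmorphism_ext.
  have : hmap (f (k + n)%N) (pmap (lrcomp c3 (lrcomp c2 e1)) x +
      pmap (lrcomp c3 e2) x - pmap e3 x) = 0.
    by rewrite raddfB raddfD /= f1 f2 f3 -raddfD -raddfD -raddfB -raddfB /= subrr !raddf0.
  move=> /fker/eqP; rewrite mulrnBl mulrnDl -g1 -g2 -g3 subr_eq0 => /eqP e.
  apply: (pmap_inj jI); apply: (@pd_inc_inj H1 k n).
  by rewrite -[LHS]e -!raddfD.
pose g : ghom (H2 n) (H1 n) := GHom zD.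
exists g => B y.
have gE : hmap g y = pmap y (z : gpoint (H1 n) (H2 n)) by [].
suff e : hmap (f n) (z : gpoint (H1 n) (H2 n)) = idp (H2 n) *+ p ^ N.
  by rewrite gE -pmap_hmap e raddfMn /= pmap_idp.
apply: (pmap_inj hI); apply: (@pd_inc_inj H2 k n).
rewrite pmap_hmap -ph_inc.
have -> : pmap h (z : gpoint (H1 n) (H2 n)) = z' by [].
by rewrite z'E !raddfMn /= xE.
Qed.
End QuasiInverse.

(** * Equality of heights *)

Section Heights.
Variables (H1 H2 : pdiv_group S p).
Hypothesis domS : forall x y : S, x * y = 0 -> x = 0 \/ y = 0.
Hypotheses (p_gt1 : (1 < p)%N) (p0 : p%:R != 0 :> S).

(* Count the points in a domain where H1[p^(k+N)] is split. *)
Lemma pd_order_le k N (phi : ghom (H1 (k + N)%N) (H2 (k + N)%N)) :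
  (forall B (x : gpoint (H1 (k + N)%N) B), hmap phi x = 0 -> x *+ p ^ N = 0) ->
  ((k + N) * pd_ht H1 <= (k + N) * pd_ht H2 + N * pd_ht H1)%N.
Proof.
move=> phiN; rewrite -(leq_exp2l _ _ p_gt1) expnD.
set m1 := (p ^ _)%N; set m2 := (p ^ _)%N; set m3 := (p ^ _)%N.
have [B [x [dom pB xI]]] :=
  points_exist (pd_rank H1 (k + N)%N) (@pd_killed _ _ H1 (k + N)%N) domS p0.
(* The [m1] points are sorted by their images: there are at most [m2] images, and each fibre has at
   most [m3] points. *)
pose ys := undup (codom (fun i => hmap phi (x i))).
pose c (i : 'I_m1) : 'I_(size ys) :=
  Ordinal (etrans (index_mem _ _)
    (etrans (mem_undup _ _) (codom_f (fun i => hmap phi (x i)) i))).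
have ysm2 : (size ys <= m2)%N.
  apply: (points_rank (pd_rank H2 (k + N)%N) (@pd_killed _ _ H2 (k + N)%N) dom pB
    (x := fun i : 'I_(size ys) => nth 0 ys i)) => i j /eqP.
  by rewrite nth_uniq ?undup_uniq // => /eqP/val_inj.
have fiber j : (#|[pred i | c i == j]| <= m3)%N.
  (* Subtracting a base point moves a fibre injectively into the points killed by p^N, which come
     from level [N] of [H1]. *)
  case: (posnP #|[pred i | c i == j]|) => [->//|F0].
  pose i0 := enum_val (Ordinal F0).
  pose w (s : 'I_#|[pred i | c i == j]|) := x (enum_val s) - x i0.
  have wN s : w s *+ p ^ N = 0.
    apply: phiN; rewrite raddfB /=; apply/eqP; rewrite subr_eq0; apply/eqP.
    have cj u : c (@enum_val _ [pred i | c i == j] u) = j by exact/eqP/(enum_valP u).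
    have := congr1 val (etrans (cj s) (esym (cj (Ordinal F0)))); rewrite /= -/i0.
    have cE i : nth 0 ys (index (hmap phi (x i)) ys) = hmap phi (x i).
      by rewrite nth_index // mem_undup codom_f.
    by move=> /(congr1 (nth 0 ys)); rewrite !cE.
  have /choice[z zE] s := pd_inc_torsion (wN s).
  apply: (points_rank (pd_rank H1 N) (@pd_killed _ _ H1 N) dom pB (x := z)) => s t st.
  have : w s = w t by rewrite -!zE st.
  by move=> /addIr/xI/enum_val_inj.
rewrite -[m1]card_ord -sum1_card (partition_big c xpredT) //=.
apply: (@leq_trans (\sum_(j < size ys) m3)).
  apply: leq_sum => j _; rewrite sum1_card; exact: fiber.
by rewrite sum_nat_const card_ord leq_mul2r ysm2 orbT.
Qed.

(** The error [N * pd_ht H1] does not grow with the level; at a level exceeding it, a height gap of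
    at least 1 would outweigh it. *)
Lemma pd_ht_le N (phi : forall n, ghom (H1 n) (H2 n)) :
  (forall n B (x : gpoint (H1 n) B), hmap (phi n) x = 0 -> x *+ p ^ N = 0) ->
  (pd_ht H1 <= pd_ht H2)%N.
Proof.
move=> phiN; rewrite leqNgt; apply/negP => h21.
have := @pd_order_le (N * pd_ht H1).+1 N (phi _) (phiN _).
have : (N * pd_ht H1 < (N * pd_ht H1).+1 + N)%N by rewrite leq_addr.
move: (_ + N)%N => A NA.
have : (A * (pd_ht H2).+1 <= A * pd_ht H1)%N by rewrite leq_mul2l h21 orbT.
rewrite mulnS; lia.
Qed.
End Heights.
End Towers.

Theorem proposition3 (R : realType) (p : nat) (K : fieldType)
    (v : valuation K R) (H1 H2 : pdiv_group (val_ring v) p) :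
  prime p -> v p%:R = 1%E -> complete_for v ->
  isogenous H1 H2 ->
  pd_ht H1 = pd_ht H2 /\
  (forall x : R, 0 <= x <= (pd_ht H1)%:R -> HN_pdiv H1 x = HN_pdiv H2 x).
Proof.
move=> p_pr vp _ [f [fepi [N [E [iota [_ _ _ fker0]]]]]].
have fker n B (x : gpoint (H1 n) B) : hmap (f n) x = 0 -> x *+ p ^ N = 0.
  by move=> fx; rewrite -pmulnE; apply: (fker0 n B x fx).
pose g n := sval (cid (quasi_inverse fepi fker n)).
have gE n B (y : gpoint (H2 n) B) : hmap (f n) (hmap (g n) y) = y *+ p ^ N.
  exact: (svalP (cid (quasi_inverse fepi fker n))).
have gker n B (y : gpoint (H2 n) B) : hmap (g n) y = 0 -> y *+ p ^ N = 0.
  by move=> gy; rewrite -gE gy raddf0.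
have p0 : p%:R != 0 :> val_ring v by have := pn_neq0 vp 1; rewrite expn1.
have dom := @val_ring_domain R K v.
have p1 := prime_gt1 p_pr.
have h12 : pd_ht H1 = pd_ht H2.
  apply/eqP; rewrite eqn_leq (pd_ht_le dom p1 p0 fker).
  exact: (pd_ht_le dom p1 p0 gker).
split=> // x /andP[x0 xh].
have [d1 u1] := pd_cotangent_gens H1; have [d2 u2] := pd_cotangent_gens H2.
(* The two summands bound the gap in the two directions, through f and through its quasi-inverse.
   Generators are available from level 1 on, hence the indices n + 1. *)
apply: (@HN_pdiv_eq _ _ _ _ _ _ (N * d1 + N * d2)%:R) => n.
have nx : 0 <= n.+1%:R * x <= (n.+1 * pd_ht H1)%:R.
  by rewrite mulr_ge0 // natrM ler_wpM2l.
have [w1 g1] := u1 n; have [w2 g2] := u2 n.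
have le1 := HN_le vp p_pr h12 (@fker n.+1) g1 nx.
have le2 := HN_le vp p_pr (esym h12) (@gker n.+1) g2.
rewrite -h12 in le2; have {}le2 := le2 _ nx.
rewrite ler_distl natrD; apply/andP; split.
  by rewrite lerBlDr (le_trans le2) // lerD2l lerDr.
by rewrite (le_trans le1) // lerD2l lerDl.
Qed.
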